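(* Let $\mathbb{P}_n(1)$ be the complex projective space of complex dimension $n$ and holomorphic sectional curvature $c=1$, regarded as a regular torification of $\mathcal{P}_{n+1}^{\times}$. For a Hermitian matrix $H$ of size $n+1$ let $f_H:\mathbb{P}_n(1)\to\mathbb{R}$, $f_H([z])=\frac{\langle z,Hz\rangle}{\langle z,z\rangle}$, where $\langle z,w\rangle=\sum_k\overline{z}_kw_k$. Then, for every Hermitian matrix $H$ of size $n+1$, $\mathrm{spec}(f_H)=\mathrm{spec}(H)$, where $\mathrm{spec}(f_H)$ is the spectrum of the Kähler function $f_H$ and $\mathrm{spec}(H)$ is the set of eigenvalues of $H$.
   Context: $\mathcal{P}_{n+1}^\times$ is the set of functions $p:\Omega\to\mathbb{R}$ on the finite set $\Omega=\{x_1,\dots,x_{n+1}\}$ with $p(x)>0$ for all $x$ and $\sum_xp(x)=1$. It is an exponential family: $p_\theta(x)=\exp\big(\sum_{i=1}^n\theta_iF_i(x)-\psi(\theta)\big)$, $\theta\in\mathbb{R}^n$, $F_i(x_j)=\delta_{ij}$, $\psi(\theta)=\ln(1+\sum_ie^{\theta_i})$. The space $\mathcal{A}_{\mathcal{E}}$ spanned by $F_1,\dots,F_n,1$ is the space of all real functions on $\Omega$, and $F=(F_1,\dots,F_n)$ is injective. $\mathcal{P}_{n+1}$ denotes the set of all probability functions on $\Omega$, which is the closure of $\mathcal{P}^\times_{n+1}$ for pointwise convergence. $\mathbb{E}_p(X)=\sum_xX(x)p(x)$. General definitions. For an exponential family $\mathcal{E}=\{p_\theta\}_{\theta\in\mathbb{R}^n}$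 over a finite set, with Fisher metric $(h_F)_{ij}(\theta)=\mathbb{E}_{p_\theta}(\partial_i\ln p_\theta\,\partial_j\ln p_\theta)$ and the flat connection $\nabla^{(e)}$ having $\theta$ as affine coordinates, $T\mathcal{E}$ (coordinates $(\theta,\dot\theta)$ for $\sum\dot\theta_k\partial/\partial\theta_k|_{p_\theta}$) is Kähler with holomorphic coordinates $z_k=\theta_k+i\dot\theta_k$ and metric $\mathrm{diag}(h_F(\theta),h_F(\theta))$. A parallel lattice $L$ is the set of integer combinations of a frame $Y=(Y_1,\dots,Y_n)$ of $\nabla^{(e)}$-parallel vector fields (a generator); $\Gamma(L)$ is the group of translations $u\mapsto u+\sum k_iY_i$, $k_i\in\mathbb{Z}$, $\mathcal{E}_L=T\mathcal{E}/\Gamma(L)$ with quotient map $q_L$ and projection $\pi_L:\mathcal{E}_L\to\mathcal{E}$, with torus action $\Phi_Y([t],q_L(u))=q_L(u+\sum t_iY_i)$ of $\mathbb{T}^n=\mathbb{R}^n/\mathbb{Z}^n$. A connected Kähler manifold $N$ of complex dimension $n$ with effective holomorphic isometric $\mathbb{T}^n$-action $\Phi$, free locus $N^\circ$, is a torification of $\mathcal{E}$ if there are such $L,Y$ and an equivariant holomorphic isometric diffeomorphism $G:\mathcal{E}_L\to N^\circ$; it is regular if moreover $N$ is simply connected, complete, with real-analytic metric. The maps $\kappa=\pi_L\circ G^{-1}:N^\circ\to\mathcal{E}$ so obtained are the compatible projections; when $N$ is compact each has a unique continuous extension $K:N\to\overline{\mathcal{E}}$ (its natural extension), $\overline{\mathcal{E}}$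 being the closure of $\mathcal{E}$ in the set of all probability functions. $\mathbb{P}_n(1)$ carries the Fubini–Study metric of holomorphic sectional curvature $1$ and the action $\Phi([t],[z])=[e^{2i\pi t_1}z_1,\dots,e^{2i\pi t_n}z_n,z_{n+1}]$; it is a regular torification of $\mathcal{P}_{n+1}^\times$, and $K([z])(x_k)=|z_k|^2/\langle z,z\rangle$ is the natural extension of a compatible projection. Kähler functions and spectrum. A smooth $f:N\to\mathbb{R}$ is Kähler if its Hamiltonian vector field is Killing. $H\mapsto f_H$ is a linear bijection from Hermitian matrices of size $n+1$ onto Kähler functions on $\mathbb{P}_n(1)$. When $N$ is a Kähler toric manifold that is a regular torification of $\mathcal{E}$ and $F$ is injective, every Kähler function can be written $f(p)=\mathbb{E}_{K(\phi(p))}(X)$ for all $p\in N$, with $X\in\mathcal{A}_{\mathcal{E}}$, $\phi$ in the identity component of the group of holomorphic isometries of $N$, and $K$ the natural extension of a compatible projection; $\mathrm{spec}(f)$ is defined as the image of $X$, which does not depend on the choice of $K,\phi,X$. *)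

(* Defs.v *)
From HB Require Import structures.
From mathcomp Require Import all_boot all_order all_algebra.
From mathcomp Require Import generic_quotient complex.
From mathcomp Require Import all_classical all_reals all_analysis.

Set Implicit Arguments.
Unset Strict Implicit.
Unset Printing Implicit Defensive.
Import Order.TTheory GRing.Theory Num.Theory numFieldNormedType.Exports.

Local Open Scope classical_set_scope.
Local Open Scope ring_scope.
Local Open Scope quotient_scope.

(* R[i], named so that the topological and normed structures of a numFieldType
   are found on it and on 'cV[Cx R]_n. *)
Definition Cx (R : realType) : numClosedFieldType := R[i].

Section Complex.
Context {R : realType}.

Definition reC (z : Cx R) : R := complex.Re z.
Definition imC (z : Cx R) : R := complex.Im z.

Definition toC (a : R) : Cx R := (a%:C)%C.

Definition cis (a : R) : Cx R := (cos a +i* sin a)%C.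

Definition cvec n (a b : 'cV[R]_n) : 'cV[Cx R]_n :=
  \col_k (a k 0 +i* b k 0)%C.

Definition re_vec n (z : 'cV[Cx R]_n) : 'cV[R]_n := map_mx reC z.

Definition inner n (z w : 'cV[Cx R]_n) : Cx R := \sum_k (z k 0)^* * w k 0.

Definition int_vec n (k : 'cV[int]_n) : 'cV[R]_n := map_mx intr k.

End Complex.

(* The data of a complex manifold of dimension n with a Riemannian metric: the
   maps [kparam i], restricted to the open sets [kdom i], are the inverses of
   the holomorphic charts, and [kmetric i z] is the metric at [kparam i z], read
   in chart i, on tangent vectors of C^n seen as a real vector space.  The
   axioms of a Kähler manifold are not part of the record; it is only used for
   the two manifolds [toricE] and [projS] below. *)
Record kahlerData (R : realType) (n : nat) := KahlerData {
  kpoint :> topologicalType ;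
  kindex : Type ;
  kdom : kindex -> set 'cV[Cx R]_n ;
  kparam : kindex -> 'cV[Cx R]_n -> kpoint ;
  kmetric : kindex -> 'cV[Cx R]_n -> 'cV[Cx R]_n -> 'cV[Cx R]_n -> R }.

Section Maps.
Context {R : realType}.

(* [differentiable] and ['d] are over the scalar field [Cx R]: near each point
   of A, f is given in charts by a map g that is complex differentiable at that
   point and whose differential preserves the metric. *)
Definition hol_isometric_on n m (M : kahlerData R n) (N : kahlerData R m)
    (A : set M) (f : M -> N) :=
  forall (i : kindex M) (z : 'cV[Cx R]_n), kdom i z -> A (kparam i z) ->
  exists (j : kindex N) (g : 'cV[Cx R]_n -> 'cV[Cx R]_m),
    [/\ \forall y \near z, kdom j (g y) /\ f (kparam i y) = kparam j (g y),
        differentiable g z &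
        forall v w, kmetric j (g z) ('d g z v) ('d g z w) = kmetric i z v w].

Definition hol_isometric_diffeo n m (M : kahlerData R n) (N : kahlerData R m)
    (A : set M) (B : set N) (f : M -> N) :=
  [/\ set_bij A B f, hol_isometric_on A f &
      exists g : N -> M, (forall x, A x -> g (f x) = x) /\
                         hol_isometric_on B g].

Definition hol_isometries n (N : kahlerData R n) :
    set {compact-open, N -> N} :=
  [set phi | hol_isometric_diffeo [set: N] [set: N] phi].

Definition identity_component n (N : kahlerData R n) :
    set {compact-open, N -> N} :=
  connected_component (@hol_isometries n N) (idfun : N -> N).

(* An action of the torus R^n / Z^n is given as a function of representatives
   t in R^n. *)
Definition free_locus n (N : kahlerData R n) (Phi : 'cV[R]_n -> N -> N) :
    set N :=
  [set x | forall t, Phi t x = x -> exists k : 'cV[int]_n, t = int_vec k].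

End Maps.

Section ExponentialFamily.
Context {R : realType} {n : nat} {Omega : finType}.

Definition expect (q X : Omega -> R) : R := \sum_x X x * q x.

Definition expfam (F : 'I_n -> Omega -> R) (psi : 'cV[R]_n -> R)
    (theta : 'cV[R]_n) (x : Omega) : R :=
  expR (\sum_i theta i 0 * F i x - psi theta).

Definition obs_space (F : 'I_n -> Omega -> R) : set (Omega -> R) :=
  [set X | exists (c0 : R) (c : 'I_n -> R),
     forall x, X x = \sum_i c i * F i x + c0].

Variable p : 'cV[R]_n -> Omega -> R.

Definition fisher (theta : 'cV[R]_n) (i j : 'I_n) : R :=
  let score k (x : Omega) : R :=
    'D_(delta_mx k 0) (fun t => ln (p t x)) theta in
  expect (p theta) (fun x => score i x * score j x).

(* The tangent bundle is identified with C^n by z = theta + i theta-dot. *)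
Definition tangent_metric (z v w : 'cV[Cx R]_n) : R :=
  \sum_i \sum_j fisher (re_vec z) i j *
    (reC (v i 0) * reC (w j 0) + imC (v i 0) * imC (w j 0)).

(* Column i of Y holds the constant components of the parallel field Y_i in the
   frame d/dtheta_k, so that this is u + sum_i t_i Y_i. *)
Definition fibre_shift (Y : 'M[R]_n) (t : 'cV[R]_n) (u : 'cV[Cx R]_n) :
    'cV[Cx R]_n := u + cvec 0 (Y *m t).

Definition lattice_rel (Y : 'M[R]_n) (u v : 'cV[Cx R]_n) : bool :=
  `[< exists k : 'cV[int]_n, v = fibre_shift Y (int_vec k) u >].

Lemma fibre_shiftD Y s t u :
  fibre_shift Y s (fibre_shift Y t u) = fibre_shift Y (s + t) u.
Proof.
rewrite /fibre_shift -addrA mulmxDr; congr (_ + _).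
apply/colP => k; rewrite !mxE; apply/eqP.
by rewrite eq_complex /= !addr0 addrC !eqxx.
Qed.

Lemma fibre_shift0 Y u : fibre_shift Y 0 u = u.
Proof.
rewrite /fibre_shift mulmx0 -[RHS]addr0; congr (_ + _).
by apply/colP => k; rewrite !mxE.
Qed.

Lemma lattice_rel_refl Y : reflexive (lattice_rel Y).
Proof.
move=> u; apply/asboolP; exists 0.
by rewrite (_ : int_vec 0 = 0) ?fibre_shift0// /int_vec map_mx0.
Qed.

Lemma lattice_rel_sym Y : symmetric (lattice_rel Y).
Proof.
suff h u v : lattice_rel Y u v -> lattice_rel Y v u.
  by move=> u v; apply/idP/idP; exact: h.
move=> /asboolP[k ->]; apply/asboolP; exists (- k).
by rewrite fibre_shiftD /int_vec map_mxN addNr fibre_shift0.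
Qed.

Lemma lattice_rel_trans Y : transitive (lattice_rel Y).
Proof.
move=> v u w /asboolP[k ->] /asboolP[l ->]; apply/asboolP; exists (l + k).
by rewrite fibre_shiftD /int_vec map_mxD.
Qed.

Definition lattice_equiv (Y : 'M[R]_n) : equiv_rel 'cV[Cx R]_n :=
  EquivRel (lattice_rel Y) (@lattice_rel_refl Y) (@lattice_rel_sym Y)
    (@lattice_rel_trans Y).

Definition toricE_pt (Y : 'M[R]_n) : topologicalType :=
  quotient_topology {eq_quot lattice_equiv Y}.

Definition qL (Y : 'M[R]_n) (u : 'cV[Cx R]_n) : toricE_pt Y :=
  \pi_(quotient_topology {eq_quot lattice_equiv Y}) u.

(* The charts are the inverses of q_L on the open sets where it is injective.
   The metric of the tangent bundle is invariant under the lattice, hence it is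
   also the expression of the quotient metric in these charts. *)
Definition toricE (Y : 'M[R]_n) : kahlerData R n :=
  @KahlerData R n (toricE_pt Y)
    {U : set 'cV[Cx R]_n | open U /\ set_inj U (qL Y)}
    sval (fun=> qL Y) (fun=> tangent_metric).

Section Torification.
Variables (N : kahlerData R n) (Phi : 'cV[R]_n -> N -> N).

(* The values of kappa outside of the free locus are irrelevant. *)
Definition compatible_projection (kappa : N -> Omega -> R) :=
  exists (Y : 'M[R]_n) (G : toricE Y -> N),
    [/\ Y \in unitmx,
        hol_isometric_diffeo [set: toricE Y] (free_locus Phi) G,
        forall t u, G (qL Y (fibre_shift Y t u)) = Phi t (G (qL Y u)) &
        forall u, kappa (G (qL Y u)) = p (re_vec u)].

Definition natural_extension (K : N -> Omega -> R) :=
  exists kappa : N -> Omega -> R,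
    [/\ compatible_projection kappa,
        forall x, free_locus Phi x -> K x = kappa x,
        continuous (K : N -> {ptws Omega -> R}) &
        forall x, closure (range p : set {ptws Omega -> R}) (K x)].

(* S is the spectrum of the function f on the torification N, where F_i are the
   functions defining the exponential family p. *)
Definition is_spectrum (F : 'I_n -> Omega -> R) (f : N -> R) (S : set R) :=
  exists (K : N -> Omega -> R) (phi : N -> N) (X : Omega -> R),
    [/\ natural_extension K, identity_component phi, obs_space F X,
        forall x, f x = expect (K (phi x)) X & S = range X].

End Torification.
End ExponentialFamily.

Section Simplex.
Context {R : realType} {n : nat}.

(* The points x_1, ..., x_(n+1) are the elements of 'I_n.+1 in order; i : 'I_n
   and lift ord_max i have the same value. *)
Definition simplexF (i : 'I_n) (x : 'I_n.+1) : R := (x == lift ord_max i)%:R.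

Definition simplex_psi (theta : 'cV[R]_n) : R :=
  ln (1 + \sum_i expR (theta i 0)).

Definition simplex : 'cV[R]_n -> 'I_n.+1 -> R := expfam simplexF simplex_psi.

End Simplex.

Section ProjectiveSpace.
Context {R : realType} {n : nat}.

Definition nzvec : Type := [set z : 'cV[Cx R]_n.+1 | z != 0].

Definition proj_rel (z w : nzvec) : bool :=
  `[< exists l : Cx R, val w = l *: val z >].

Lemma nzvec_neq0 (z : nzvec) : val z != 0.
Proof. by case: z => z /= zP; exact: (set_mem zP). Qed.

Lemma proj_rel_refl : reflexive proj_rel.
Proof. by move=> z; apply/asboolP; exists 1; rewrite scale1r. Qed.

Lemma proj_rel_sym : symmetric proj_rel.
Proof.
suff h z w : proj_rel z w -> proj_rel w z.
  by move=> z w; apply/idP/idP; exact: h.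
move=> /asboolP[l wE]; apply/asboolP; exists l^-1.
have l0 : l != 0.
  by apply: contra (nzvec_neq0 w) => /eqP l0; rewrite wE l0 scale0r.
by rewrite wE scalerA mulVf// scale1r.
Qed.

Lemma proj_rel_trans : transitive proj_rel.
Proof.
move=> w z v /asboolP[l wE] /asboolP[m vE]; apply/asboolP; exists (m * l).
by rewrite vE wE scalerA.
Qed.

Definition proj_equiv : equiv_rel nzvec :=
  EquivRel proj_rel proj_rel_refl proj_rel_sym proj_rel_trans.

Definition proj_pt : topologicalType :=
  quotient_topology {eq_quot proj_equiv}.

Lemma ones_neq0 : const_mx 1 \in [set z : 'cV[Cx R]_n.+1 | z != 0].
Proof.
apply/mem_set/eqP => /colP/(_ 0); rewrite !mxE => /eqP.
by rewrite oner_eq0.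
Qed.

Definition ones : nzvec := exist _ (const_mx 1) ones_neq0.

(* [z]; only used on nonzero vectors. *)
Definition proj (z : 'cV[Cx R]_n.+1) : proj_pt :=
  \pi_(quotient_topology {eq_quot proj_equiv})
    (insubd ones z).

Definition proj_repr (x : proj_pt) : 'cV[Cx R]_n.+1 :=
  val (repr (x : quotient_topology {eq_quot proj_equiv})).

(* The vector with a at place k and the entries of w, in order, elsewhere. *)
Definition insert (k : 'I_n.+1) (a : Cx R) (w : 'cV[Cx R]_n) :
    'cV[Cx R]_n.+1 :=
  \col_j (if unlift k j is Some i then w i 0 else a).

(* The Fubini-Study metric at [z], on the images of v, w in C^(n+1) under the
   differential of z |-> [z]; the factor 4 makes the holomorphic sectional
   curvature 1. *)
Definition fubini_study (z v w : 'cV[Cx R]_n.+1) : R :=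
  4 * reC ((inner z z * inner v w - inner v z * inner z w) /
           inner z z ^+ 2).

(* P_n(1), with its n+1 affine charts. *)
Definition projS : kahlerData R n :=
  @KahlerData R n proj_pt 'I_n.+1 (fun=> [set: 'cV[Cx R]_n])
    (fun k w => proj (insert k 1 w))
    (fun k w v v' => fubini_study (insert k 1 w) (insert k 0 v) (insert k 0 v')).

Definition proj_torus (t : 'cV[R]_n) (x : projS) : projS :=
  let z := proj_repr x in
  proj (\col_j (if unlift ord_max j is Some i
                then cis (2 * pi * t i 0) * z j 0 else z j 0)).

(* For Hermitian H the quotient is real, and reC only changes its type. *)
Definition fH (H : 'M[Cx R]_n.+1) (x : projS) : R :=
  let z := proj_repr x in reC (inner z (H *m z) / inner z z).

Definition spec_mx (H : 'M[Cx R]_n.+1) : set (Cx R) := [set a | eigenvalue H a].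

Lemma proj_repr_proj (z : 'cV[Cx R]_n.+1) : z != 0 ->
  exists2 l : Cx R, l != 0 & proj_repr (proj z) = l *: z.
Proof.
move=> z0; rewrite /proj /proj_repr; set y := insubd _ z.
have yE : val y = z by rewrite /y insubdK//; exact/mem_set.
have /eqmodP/asboolP[l lE] : y = repr (\pi_({eq_quot proj_equiv}) y)
    %[mod {eq_quot proj_equiv}] by rewrite reprK.
exists l; last by rewrite -yE.
by apply: contraNneq (nzvec_neq0 (repr (\pi_({eq_quot proj_equiv}) y))) => l0;
  rewrite lE l0 scale0r.
Qed.

Lemma proj_scale (l : Cx R) (z : 'cV[Cx R]_n.+1) : l != 0 -> z != 0 ->
  proj (l *: z) = proj z.
Proof.
move=> l0 z0; apply/esym/eqmodP/asboolP; exists l.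
have lz0 : l *: z != 0 by rewrite scaler_eq0 negb_or l0.
by rewrite !insubdK//; exact/mem_set.
Qed.

Lemma fH_proj (H : 'M[Cx R]_n.+1) z : z != 0 ->
  fH H (proj z) = reC (inner z (H *m z) / inner z z).
Proof.
move=> z0; rewrite /fH; have [l l0 ->] := proj_repr_proj z0.
have E (v w : 'cV[Cx R]_n.+1) : inner (l *: v) (l *: w) =
    (l^* * l) * inner v w.
  rewrite /inner mulr_sumr; apply: eq_bigr => k _.
  by rewrite !mxE rmorphM mulrACA.
rewrite -scalemxAr !E invfM mulrACA divff ?mul1r//.
by rewrite mulf_neq0// conjC_eq0.
Qed.

Lemma proj_torus_proj t (z : 'cV[Cx R]_n.+1) : z != 0 ->
  proj_torus t (proj z) =
  proj (\col_j (if unlift ord_max j is Some i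
                then cis (2 * pi * t i 0) * z j 0 else z j 0)).
Proof.
move=> z0; rewrite /proj_torus; have [l l0 ->] := proj_repr_proj z0.
set w := RHS; rewrite {}/w -[RHS](@proj_scale l)//; last first.
  apply: contraNneq z0 => /colP w0; apply/eqP/colP => j.
  have := w0 j; rewrite !mxE; case: (unlift _ _) => // i /eqP.
  rewrite mulf_eq0 => /orP[|/eqP//]; rewrite eq_complex /= => /andP[c0 s0].
  have := cos2Dsin2 (2 * pi * t i 0); rewrite (eqP c0) (eqP s0) expr0n/= addr0.
  by move/esym/eqP; rewrite oner_eq0.
by congr proj; apply/colP => j; rewrite !mxE; case: unlift => // i;
  rewrite mulrCA.
Qed.

End ProjectiveSpace.
Arguments projS R n : clear implicits.
Arguments proj_torus R n : clear implicits.
Arguments simplex R n : clear implicits.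
Arguments simplexF R n : clear implicits.

(* Main.v *)
From HB Require Import structures.
From mathcomp Require Import all_boot all_order all_algebra.
From mathcomp Require Import generic_quotient complex ring lra zify.
From mathcomp Require Import all_classical all_reals all_analysis.
Require Import Defs.

(** Uniqueness.  Both sides of [f_H = E_(K o phi)(X)] have explicit gradients.
    For the Fubini-Study metric the gradient of [f_A] at [z] is half the
    horizontal part of [A z], and two such gradients pair to
    [f_(A B) - f_A f_B] (real part); for the Fisher metric the gradient of
    [theta |-> E_theta(X)] is the coefficient vector of [X], and two such
    gradients pair to the covariance.  As [phi] and the torification are
    isometric, an induction on [m] gives [f_(H^m) = E_(K o phi)(X^m)] on the
    open set that [phi] maps into the free locus, hence
    [|P(H) z|^2 / |z|^2 = sum_x |P(X x)|^2 p(x)] with [p > 0], for every complex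
    polynomial [P].  The minimal polynomial of [H] and the product of the
    ['X - X x] give the two inclusions between the image of [X] and the spectrum
    of [H]; neither the isometries of the projective space nor the compatible
    projections have to be classified.

    Existence.  Write [H = U^-1 D U] with [U] unitary and [D] diagonal, and take
    [X = D], [phi [z] = [U z]] and [K [z] = (|z_k|^2 / |z|^2)_k].  The map
    [u |-> [exp (u_1 / 2) : ... : exp (u_n / 2) : 1]] exhibits [K] as a natural
    extension, and if [U = V^-1 diag(e^(i a_k)) V] then
    [s |-> V^-1 diag(e^(i s a_k)) V] joins [phi] to the identity. *)

Set Implicit Arguments.
Unset Strict Implicit.
Unset Printing Implicit Defensive.
Import Order.TTheory GRing.Theory Num.Theory numFieldNormedType.Exports.

Local Open Scope classical_set_scope.
Local Open Scope ring_scope.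
Local Open Scope quotient_scope.

(** * Complex numbers through their real and imaginary parts *)

Section ComplexNumbers.
Context {R : realType}.
Implicit Types (z w : Cx R) (a b : R).

Fact toC_is_zmod : zmod_morphism (@toC R).
Proof. exact: (@raddfB _ _ (real_complex R)). Qed.
Fact toC_is_monoid : monoid_morphism (@toC R).
Proof.
by split; [exact: (rmorph1 (real_complex R))|exact: (rmorphM (real_complex R))].
Qed.
HB.instance Definition _ := GRing.isZmodMorphism.Build R (Cx R) (@toC R)
  toC_is_zmod.
HB.instance Definition _ :=
  GRing.isMonoidMorphism.Build R (Cx R) (@toC R) toC_is_monoid.

Fact reC_is_zmod : zmod_morphism (@reC R).
Proof. by move=> [a b] [c d]. Qed.
HB.instance Definition _ := GRing.isZmodMorphism.Build (Cx R) R (@reC R)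
  reC_is_zmod.
Fact imC_is_zmod : zmod_morphism (@imC R).
Proof. by move=> [a b] [c d]. Qed.
HB.instance Definition _ := GRing.isZmodMorphism.Build (Cx R) R (@imC R)
  imC_is_zmod.

Lemma reC_toC a : reC (toC a) = a. Proof. by []. Qed.
Lemma imC_toC a : imC (toC a) = 0. Proof. by []. Qed.
Lemma toC_inj : injective (@toC R). Proof. by move=> a b []. Qed.

Lemma eqCx z w : reC z = reC w -> imC z = imC w -> z = w.
Proof. by case: z w => [a b] [c d]; rewrite /reC /imC /= => -> ->. Qed.

Lemma reCB z w : reC (z - w) = reC z - reC w. Proof. exact: raddfB. Qed.
Lemma imCB z w : imC (z - w) = imC z - imC w. Proof. exact: raddfB. Qed.
Lemma reCM z w : reC (z * w) = reC z * reC w - imC z * imC w.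
Proof. by case: z w => [a b] [c d]. Qed.
Lemma imCM z w : imC (z * w) = reC z * imC w + imC z * reC w.
Proof. by case: z w => [a b] [c d]. Qed.

Lemma reC_conj z : reC z^* = reC z.
Proof. by case: z. Qed.
Lemma imC_conj z : imC z^* = - imC z.
Proof. by case: z. Qed.
Lemma reCMl a z : reC (toC a * z) = a * reC z.
Proof. by rewrite reCM reC_toC imC_toC mul0r subr0. Qed.
Lemma imCMl a z : imC (toC a * z) = a * imC z.
Proof. by rewrite imCM reC_toC imC_toC mul0r addr0. Qed.
Lemma conj_toC a : (toC a)^* = toC a.
Proof. by apply: eqCx; rewrite ?reC_conj// imC_conj imC_toC oppr0. Qed.
Lemma toCV a : toC a^-1 = (toC a)^-1.
Proof. exact: (fmorphV (@toC R)). Qed.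

Lemma toC_eq0 a : (toC a == 0) = (a == 0).
Proof. exact: (fmorph_eq0 (@toC R)). Qed.

(** The squared modulus with values in [R], where order arguments are simpler than in [Cx R]. *)
Definition sqnorm z : R := reC z ^+ 2 + imC z ^+ 2.
Lemma conj_mul z : z^* * z = toC (sqnorm z).
Proof.
by case: z => a b; apply: eqCx; rewrite ?reCM ?imCM ?reC_conj ?imC_conj /sqnorm
  /=;
  rewrite ?imC_toC; ring.
Qed.
Lemma sqnorm_ge0 z : 0 <= sqnorm z. Proof. by rewrite addr_ge0// sqr_ge0. Qed.
Lemma sqnorm_eq0 z : (sqnorm z == 0) = (z == 0).
Proof.
rewrite paddr_eq0 ?sqr_ge0// !sqrf_eq0; case: z => a b.
by rewrite eq_complex.
Qed.
Lemma sqnormM z w : sqnorm (z * w) = sqnorm z * sqnorm w.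
Proof. by rewrite /sqnorm reCM imCM; ring. Qed.

Lemma normCE z : `|z| = toC (Num.sqrt (sqnorm z)).
Proof. exact: normc_def. Qed.

Lemma toC_lt a b : (toC a < toC b) = (a < b).
Proof. exact: ltcR. Qed.
Lemma toC_le a b : (toC a <= toC b) = (a <= b).
Proof. exact: lecR. Qed.
Lemma norm_toC a : `|toC a| = toC `|a|.
Proof. by rewrite normCE /sqnorm reC_toC imC_toC expr0n addr0 sqrtr_sqr. Qed.

Lemma gt0_toC z : 0 < z -> exists2 a, 0 < a & z = toC a.
Proof.
move=> z0; exists (reC z).
  by move: z0; rewrite ltcE => /andP[].
by move: z0; rewrite ltcE => /andP[/eqP h _]; apply: eqCx.
Qed.

Lemma norm_reC z : toC `|reC z| <= `|z|.
Proof.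
rewrite normCE toC_le -sqrtr_sqr ler_wsqrtr// /sqnorm lerDl sqr_ge0//.
Qed.
Lemma norm_imC z : toC `|imC z| <= `|z|.
Proof.
rewrite normCE toC_le -sqrtr_sqr ler_wsqrtr// /sqnorm lerDr sqr_ge0//.
Qed.
Lemma norm_le_reim z : `|z| <= toC (`|reC z| + `|imC z|).
Proof.
rewrite normCE toC_le -[leRHS]ger0_norm ?addr_ge0// -sqrtr_sqr ler_wsqrtr//.
rewrite /sqnorm sqrrD !real_normK ?num_real//.
by rewrite lerD2r lerDl mulrn_wge0// mulr_ge0.
Qed.

Lemma reC_continuous : continuous (@reC R).
Proof.
move=> z; apply/(@cvgrPdist_lt _ _ _ (nbhs z)) => e e0; near=> w.
rewrite -raddfB -toC_lt (le_lt_trans (norm_reC _))//.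
near: w; apply: cvgr_dist_lt; first exact: cvg_id.
by rewrite -[0]/(toC 0) toC_lt.
Unshelve. all: end_near. Qed.

Lemma imC_continuous : continuous (@imC R).
Proof.
move=> z; apply/(@cvgrPdist_lt _ _ _ (nbhs z)) => e e0; near=> w.
rewrite -raddfB -toC_lt (le_lt_trans (norm_imC _))//.
near: w; apply: cvgr_dist_lt; first exact: cvg_id.
by rewrite -[0]/(toC 0) toC_lt.
Unshelve. all: end_near. Qed.

Lemma toC_continuous : continuous (@toC R).
Proof.
move=> a; apply/cvgrPdist_lt => e /gt0_toC[d d0 ->]; near=> b.
rewrite -raddfB norm_toC toC_lt; near: b.
by apply: cvgr_dist_lt => //; exact: cvg_id.
Unshelve. all: end_near. Qed.

Lemma cvgC_pair {T} (F : set_system T) {FF : Filter F} (f : T -> Cx R) z :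
  reC (f x) @[x --> F] --> reC z -> imC (f x) @[x --> F] --> imC z ->
  f @ F --> z.
Proof.
move=> /cvgrPdist_lt fr /cvgrPdist_lt fi; apply/cvgrPdist_lt =>
  e /gt0_toC[d d0 ->].
have d2 : 0 < d / 2 by rewrite divr_gt0.
near=> x; apply: (le_lt_trans (norm_le_reim _)).
rewrite toC_lt [d]splitr ltrD// raddfB; near: x; [exact: fr|exact: fi].
Unshelve. all: end_near. Qed.

End ComplexNumbers.

(** * Derivatives of real functions of one variable *)

Section RealCalculus.
Context {R : realType}.
Implicit Types (f g : R -> R) (x a b : R).

Lemma cvg_is_derive f x l :
  h^-1 * (f (h + x) - f x) @[h --> 0^'] --> l -> is_derive x 1 f l.
Proof.
have E : (fun h : R => h^-1 *: ((f \o shift x) (h *: 1) - f x)) =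
    (fun h => h^-1 * (f (h + x) - f x)).
  by apply/funext => h /=; rewrite [h%:A]mulr1.
move=> fl; split; first by rewrite /derivable E; apply/cvg_ex; exists l.
by rewrite /derive E; exact: cvg_lim.
Qed.

(** Reduces the partial derivatives in [fisher] to one-variable derivatives along a line. *)
Lemma derive_line (V : normedModType R) (f : V -> R) (a v : V) (l : R) :
  is_derive (0 : R) 1 (fun h : R => f (h *: v + a)) l -> 'D_v f a = l.
Proof.
case=> _ <-; rewrite /derive.
set g1 := fun h => h^-1 *: _; set g2 := fun h => h^-1 *: _.
suff -> : g1 = g2 by [].
apply/funext => h; rewrite /g1 /g2 /=.
by rewrite addr0 scale0r add0r [h%:A]mulr1.
Qed.

Lemma is_derive_add f g x a b : is_derive x 1 f a -> is_derive x 1 g b ->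
  is_derive x 1 (fun t => f t + g t) (a + b).
Proof. by move=> fa gb; exact: (is_deriveD fa gb). Qed.

Lemma is_derive_sub f g x a b : is_derive x 1 f a -> is_derive x 1 g b ->
  is_derive x 1 (fun t => f t - g t) (a - b).
Proof. by move=> fa gb; exact: (is_deriveB fa gb). Qed.

Lemma is_derive_mul f g x a b : is_derive x 1 f a -> is_derive x 1 g b ->
  is_derive x 1 (fun t => f t * g t) (f x * b + a * g x).
Proof.
by move=> fa gb; apply: is_derive_eq (is_deriveM fa gb) _;
  rewrite -[f x *: b]/(f x * b) -[g x *: a]/(g x * a) [g x * a]mulrC.
Qed.

Lemma is_derive_mull f x a c : is_derive x 1 f a ->
  is_derive x 1 (fun t => c * f t) (c * a).
Proof.
by move=> fa; apply: is_derive_eq (is_derive_mul (is_derive_cst c x 1) fa) _;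
  rewrite mul0r addr0.
Qed.

Lemma is_derive_mulr f x a c : is_derive x 1 f a ->
  is_derive x 1 (fun t => f t * c) (a * c).
Proof.
move=> fa; under eq_fun do rewrite mulrC.
by rewrite mulrC; exact: is_derive_mull.
Qed.

Lemma is_derive_bigsum (I : finType) (f : I -> R -> R) x (a : I -> R) :
  (forall i, is_derive x 1 (f i) (a i)) ->
  is_derive x 1 (fun t => \sum_i f i t) (\sum_i a i).
Proof.
move=> fa.
have E : (fun t => \sum_i f i t) = \sum_i f i.
  by apply/funext => t; rewrite fct_sumE.
rewrite E; elim/big_ind2 : _ => // [|g b g' b' gb gb'].
  exact: is_derive_cst.
exact: is_deriveD.
Qed.

Lemma is_derive_div f g x a b : g x != 0 -> is_derive x 1 f a ->
  is_derive x 1 g b ->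
  is_derive x 1 (fun t => f t / g t) ((a * g x - f x * b) / g x ^+ 2).
Proof.
move=> g0 fa gb; apply: is_derive_eq (is_derive_mul fa (is_deriveV g0 gb)) _.
by rewrite /GRing.scale /=; field.
Qed.

End RealCalculus.

(** * The Fisher metric of the open simplex *)

Section Simplex.
Context {R : realType} {n : nat}.
Implicit Types (th : 'cV[R]_n) (x : 'I_n.+1).

Lemma simplex_pos_sum th : 0 < 1 + \sum_i expR (th i 0) :> R.
Proof. by rewrite ltr_wpDr// sumr_ge0// => i _; rewrite expR_ge0. Qed.

Lemma simplex_gt0 th x : 0 < simplex R n th x.
Proof. exact: expR_gt0. Qed.

Lemma simplexF_max i : simplexF R n i ord_max = 0.
Proof. by rewrite /simplexF (negPf (neq_lift _ _)). Qed.

Lemma simplexF_lift i j : simplexF R n i (lift ord_max j) = (j == i)%:R.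
Proof. by rewrite /simplexF (inj_eq lift_inj). Qed.

Lemma sum_simplexF (c : 'I_n -> R) x :
  \sum_i c i * simplexF R n i x = if unlift ord_max x is Some i then c i else 0.
Proof.
case: unliftP => [j ->|->]; last first.
  by rewrite big1// => i _; rewrite simplexF_max mulr0.
rewrite (bigD1 j)//= simplexF_lift eqxx mulr1 big1 ?addr0// => i ij.
by rewrite simplexF_lift eq_sym (negPf ij) mulr0.
Qed.

Lemma simplexE th x : simplex R n th x =
  expR (if unlift ord_max x is Some i then th i 0 else 0) /
  (1 + \sum_i expR (th i 0)).
Proof.
rewrite /simplex /expfam sum_simplexF expRD expRN /simplex_psi lnK//.
by rewrite posrE simplex_pos_sum.
Qed.

Lemma sum_ord_max (V : nmodType) (f : 'I_n.+1 -> V) :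
  \sum_x f x = f ord_max + \sum_(i < n) f (lift ord_max i).
Proof. by rewrite (bigD1_ord ord_max). Qed.

Lemma sum_simplex th : \sum_x simplex R n th x = 1.
Proof.
rewrite sum_ord_max simplexE unlift_none expR0.
under [X in _ + X]eq_bigr do rewrite simplexE liftK.
rewrite -mulr_suml -mulrDl divff//; exact/lt0r_neq0/simplex_pos_sum.
Qed.

Lemma expect_simplexF th i :
  expect (simplex R n th) (simplexF R n i) = simplex R n th (lift ord_max i).
Proof.
rewrite /expect sum_ord_max simplexF_max mul0r add0r (bigD1 i)//=.
rewrite simplexF_lift eqxx mul1r big1 ?addr0// => j ji.
by rewrite simplexF_lift (negPf ji) mul0r.
Qed.

(** The partial derivative in [theta_i] of the log-likelihood: the statistic [F_i] minus its
    mean. *)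
Definition score th i x := simplexF R n i x - simplex R n th (lift ord_max i).

Lemma expect_score th i : \sum_x simplex R n th x * score th i x = 0.
Proof.
under eq_bigr do rewrite mulrBr.
rewrite sumrB -mulr_suml sum_simplex mul1r -expect_simplexF /expect.
by under eq_bigr do rewrite mulrC; rewrite subrr.
Qed.

(** Stated along an arbitrary curve, so that it serves the partial derivatives in [fisher] as well
    as the curves obtained by reading an isometry in charts. *)
Lemma is_derive_log_simplex (th : R -> 'cV[R]_n) (w : 'I_n -> R) x :
  (forall i, is_derive (0 : R) 1 (fun t => th t i 0) (w i)) ->
  is_derive (0 : R) 1
    (fun t => \sum_i th t i 0 * simplexF R n i x - simplex_psi (th t))
    (\sum_i w i * score (th 0) i x).
Proof.
move=> thw; set Z := 1 + \sum_i expR (th 0 i 0).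
have d1 : is_derive (0 : R) 1 (fun t => \sum_i th t i 0 * simplexF R n i x)
    (\sum_i w i * simplexF R n i x).
  apply: is_derive_bigsum => i.
  exact: (is_derive_mulr (simplexF R n i x) (thw i)).
have d2 : is_derive (0 : R) 1 (fun t => 1 + \sum_i expR (th t i 0))
    (0 + \sum_i expR (th 0 i 0) * w i).
  have d i := is_derive1_comp (is_derive_expR (th 0 i 0)) (thw i).
  exact: (is_derive_add (is_derive_cst (1 : R) (0 : R) 1) (is_derive_bigsum d)).
have d3 := @is_derive1_comp _ _ (fun t => 1 + \sum_i expR (th t i 0)) _ _ _
  (is_derive1_ln (simplex_pos_sum (th 0))) d2.
apply: is_derive_eq (is_derive_sub d1 d3) _.
rewrite add0r mulr_sumr -sumrB; apply: eq_bigr => i _.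
by rewrite /score simplexE liftK; ring.
Qed.

Lemma is_derive_simplex (th : R -> 'cV[R]_n) (w : 'I_n -> R) x :
  (forall i, is_derive (0 : R) 1 (fun t => th t i 0) (w i)) ->
  is_derive (0 : R) 1 (fun t => simplex R n (th t) x)
    (simplex R n (th 0) x * \sum_i w i * score (th 0) i x).
Proof.
move=> thw; exact: (is_derive1_comp (is_derive_expR _) (is_derive_log_simplex x
  thw)).
Qed.

Lemma fisher_simplex th i j : fisher (simplex R n) th i j =
  \sum_x simplex R n th x * (score th i x * score th j x).
Proof.
have E k x : 'D_(delta_mx k 0) (fun t => ln (simplex R n t x)) th = score th k
  x.
  apply: derive_line.
  under eq_fun do rewrite /simplex /expfam expRK.
  have -> : score th k x = \sum_i (i == k)%:R *
      score ((fun h : R => h *: delta_mx k 0 + th) 0) i x.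
    rewrite scale0r add0r (bigD1 k)//= eqxx mul1r big1 ?addr0// => l /negPf ->.
    by rewrite mul0r.
  apply: (@is_derive_log_simplex (fun h : R => h *: delta_mx k 0 + th)) => l.
  have -> : (fun t : R => (t *: delta_mx k 0 + th) l 0) =
      (fun t => (l == k)%:R * t + th l 0).
    by apply/funext => t; rewrite !mxE andbT mulrC.
  have d1 := is_derive_mull (l == k)%:R (is_derive_id (0 : R) 1).
  apply: is_derive_eq (is_derive_add d1 (is_derive_cst (th l 0) (0 : R) 1)) _.
  by rewrite mulr1 addr0.
by rewrite /fisher /expect; apply: eq_bigr => x _; rewrite !E mulrC.
Qed.

(** The complex-linear extension of the score to tangent vectors of the complexified parameter
    space. *)
Definition cscore th (v : 'cV[Cx R]_n) x : Cx R :=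
  \sum_i v i 0 * toC (score th i x).

(** The Fisher matrix is the Gram matrix of the scores in [L^2(p)]. Taking it on both the real and
    the imaginary parts gives the real part of the Hermitian product of the complex scores. *)
Lemma tangent_metric_simplex (z v w : 'cV[Cx R]_n) :
  tangent_metric (simplex R n) z v w =
  \sum_x simplex R n (re_vec z) x *
    reC ((cscore (re_vec z) v x)^* * cscore (re_vec z) w x).
Proof.
set th := re_vec z; rewrite /tangent_metric.
have E x : reC ((cscore th v x)^* * cscore th w x) =
  \sum_i \sum_j score th i x * score th j x *
    (reC (v i 0) * reC (w j 0) + imC (v i 0) * imC (w j 0)).
  rewrite /cscore rmorph_sum mulr_suml raddf_sum; apply: eq_bigr => i _.
  rewrite mulr_sumr raddf_sum; apply: eq_bigr => j _ /=.
  rewrite rmorphM /= conj_toC !(reCM, imCM, reC_conj, imC_conj, reC_toC,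
    imC_toC).
  ring.
under [RHS]eq_bigr do rewrite E mulr_sumr.
rewrite [RHS]exchange_big; apply: eq_bigr => i _ /=.
under [RHS]eq_bigr do rewrite mulr_sumr.
rewrite [RHS]exchange_big; apply: eq_bigr => j _ /=.
rewrite fisher_simplex mulr_suml; apply: eq_bigr => x _.
by rewrite -!mulrA.
Qed.

Lemma sum_cscore th v : \sum_x toC (simplex R n th x) * cscore th v x = 0.
Proof.
under eq_bigr do rewrite /cscore mulr_sumr.
rewrite exchange_big big1// => i _ /=.
under eq_bigr do rewrite mulrCA -rmorphM.
by rewrite -mulr_sumr -rmorph_sum/= expect_score rmorph0 mulr0.
Qed.

(** The coefficients of [X] on the [F_i], the constant term being [X ord_max]; they form the
    gradient of the mean of [X]. *)
Definition obs_coef (X : 'I_n.+1 -> R) : 'cV[Cx R]_n :=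
  \col_i toC (X (lift ord_max i) - X ord_max).

(** The combination of the [F_i] with coefficients [v] is [e] minus a constant, and centring removes
    the constant. *)
Lemma cscore_shift th (v : 'cV[Cx R]_n) (e : 'I_n.+1 -> Cx R) x :
  (forall i, v i 0 = e (lift ord_max i) - e ord_max) ->
  cscore th v x = e x - \sum_y toC (simplex R n th y) * e y.
Proof.
move=> ve; rewrite /cscore /score.
under eq_bigr do rewrite rmorphB mulrBr ve.
rewrite sumrB.
have -> : \sum_i (e (lift ord_max i) - e ord_max) * toC (simplexF R n i x) =
  e x - e ord_max.
  case: (unliftP ord_max x) => [j ->|->]; last first.
    by rewrite subrr big1// => i _; rewrite simplexF_max rmorph0 mulr0.
  rewrite (bigD1 j)//= simplexF_lift eqxx rmorph1 mulr1 big1 ?addr0// => i ij.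
  by rewrite simplexF_lift eq_sym (negPf ij) rmorph0 mulr0.
have -> : \sum_y toC (simplex R n th y) * e y = e ord_max +
    \sum_i (e (lift ord_max i) - e ord_max) * toC (simplex R n th (lift ord_max
      i)).
  rewrite sum_ord_max; under [in RHS]eq_bigr do rewrite mulrBl.
  rewrite sumrB -mulr_sumr -rmorph_sum.
  have := sum_simplex th; rewrite sum_ord_max => /(canRL (addrK _)) ->.
  under [in RHS]eq_bigr do rewrite mulrC.
  rewrite rmorphB rmorph1 /=.
  by ring.
by rewrite opprD addrA.
Qed.

Lemma cscore_obs th X x :
  cscore th (obs_coef X) x = toC (X x - expect (simplex R n th) X).
Proof.
rewrite (@cscore_shift _ _ (fun y => toC (X y))) => [|i].
  rewrite rmorphB rmorph_sum; congr (_ - _); apply: eq_bigr => y _.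
  by rewrite -rmorphM mulrC.
by rewrite mxE rmorphB.
Qed.

Lemma is_derive_expect (th : R -> 'cV[R]_n) (z w : 'cV[Cx R]_n) X :
  th 0 = re_vec z ->
  (forall i, is_derive (0 : R) 1 (fun t => th t i 0) (reC (w i 0))) ->
  is_derive (0 : R) 1 (fun t => expect (simplex R n (th t)) X)
    (tangent_metric (simplex R n) z (obs_coef X) w).
Proof.
move=> th0 thw.
apply: is_derive_eq.
  apply: is_derive_bigsum => x; apply: is_derive_mull.
  exact: is_derive_simplex thw.
rewrite tangent_metric_simplex th0; set p := simplex R n (re_vec z).
(* Scores have mean zero, so [X] may be replaced by [X] minus its mean, which is the score of
   [obs_coef X]. *)
have S : \sum_x p x * reC (cscore (re_vec z) w x) = 0.
  by rewrite -[RHS]/(reC 0) -(sum_cscore (re_vec z) w) raddf_sum;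
    apply: eq_bigr => x _; rewrite /= reCMl.
transitivity (\sum_x X x * (p x * reC (cscore (re_vec z) w x))).
  apply: eq_bigr => x _; congr (_ * (_ * _)).
  by rewrite raddf_sum; apply: eq_bigr => i _; rewrite /= reCM reC_toC imC_toC
    mulr0 subr0.
under [RHS]eq_bigr do rewrite cscore_obs conj_toC reCMl.
rewrite -[LHS]subr0 -[X in _ - X](mulr0 (expect p X)) -[in X in _ - X]S
  mulr_sumr -sumrB.
by apply: eq_bigr => x _; ring.
Qed.

Lemma tangent_metric_obs (z : 'cV[Cx R]_n) X Z :
  tangent_metric (simplex R n) z (obs_coef X) (obs_coef Z) =
  expect (simplex R n (re_vec z)) (fun x => X x * Z x) -
  expect (simplex R n (re_vec z)) X * expect (simplex R n (re_vec z)) Z.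
Proof.
rewrite tangent_metric_simplex; set p := simplex R n (re_vec z).
under eq_bigr do rewrite !cscore_obs conj_toC reCMl reC_toC.
set a := expect p X; set b := expect p Z.
(* The total mass 1 turns every term into a sum over [x], so that the identity can be checked
   termwise. *)
have -> : expect p (fun x => X x * Z x) - a * b =
  expect p (fun x => X x * Z x) - a * expect p Z - b * expect p X + a * b *
    \sum_x p x.
  by rewrite sum_simplex -/a -/b; ring.
clearbody a b.
rewrite /expect [a * (\sum_x Z x * p x)]mulr_sumr
  [b * (\sum_x X x * p x)]mulr_sumr [a * b * (\sum_x p x)]mulr_sumr.
rewrite -!sumrB -big_split; apply: eq_bigr => x _ /=.
by rewrite -/p; ring.
Qed.

End Simplex.

(** * The Hermitian product on column vectors *)

Section HermitianProduct.
Context {R : realType} {n : nat}.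
Implicit Types (z v w : 'cV[Cx R]_n) (A B : 'M[Cx R]_n) (l : Cx R).

Lemma innerDl z v w : inner (z + v) w = inner z w + inner v w.
Proof.
by rewrite /inner -big_split; apply: eq_bigr => k _; rewrite mxE rmorphD mulrDl.
Qed.

Lemma innerDr z v w : inner z (v + w) = inner z v + inner z w.
Proof.
by rewrite /inner -big_split; apply: eq_bigr => k _; rewrite mxE mulrDr.
Qed.

Lemma innerZl l z w : inner (l *: z) w = l^* * inner z w.
Proof.
by rewrite /inner mulr_sumr; apply: eq_bigr => k _; rewrite mxE rmorphM mulrA.
Qed.

Lemma innerZr l z w : inner z (l *: w) = l * inner z w.
Proof.
by rewrite /inner mulr_sumr; apply: eq_bigr => k _; rewrite mxE mulrCA.
Qed.

Lemma innerBl z v w : inner (z - v) w = inner z w - inner v w.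
Proof. by rewrite innerDl -scaleN1r innerZl rmorphN1 mulN1r. Qed.

Lemma innerBr z v w : inner z (v - w) = inner z v - inner z w.
Proof. by rewrite innerDr -scaleN1r innerZr mulN1r. Qed.

Lemma inner_conj z w : (inner z w)^* = inner w z.
Proof.
by rewrite /inner rmorph_sum; apply: eq_bigr => k _;
  rewrite rmorphM/= conjCK mulrC.
Qed.

Lemma inner_sumr I (r : seq I) (P : pred I) z (F : I -> 'cV[Cx R]_n) :
  inner z (\sum_(i <- r | P i) F i) = \sum_(i <- r | P i) inner z (F i).
Proof.
elim/big_rec2 : _ => [|i y x _ <-]; last exact: innerDr.
by rewrite -(scale0r (0 : 'cV_n)) innerZr mul0r.
Qed.

Lemma inner_suml I (r : seq I) (P : pred I) z (F : I -> 'cV[Cx R]_n) :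
  inner (\sum_(i <- r | P i) F i) z = \sum_(i <- r | P i) inner (F i) z.
Proof.
rewrite -inner_conj inner_sumr rmorph_sum; apply: eq_bigr => i _.
exact: inner_conj.
Qed.

Lemma inner_adj A z w : inner z (A *m w) = inner (map_mx Num.conj A^T *m z) w.
Proof.
rewrite /inner; under eq_bigr do rewrite mxE mulr_sumr.
rewrite exchange_big; apply: eq_bigr => j _ /=.
rewrite mxE rmorph_sum mulr_suml; apply: eq_bigr => k _.
by rewrite !mxE rmorphM/= conjCK mulrCA mulrA.
Qed.

Definition sqn z : R := \sum_k sqnorm (z k 0).

Lemma inner_self z : inner z z = toC (sqn z).
Proof.
by rewrite /inner rmorph_sum; apply: eq_bigr => k _; exact: conj_mul.
Qed.

Lemma sqn_ge0 z : 0 <= sqn z.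
Proof. by apply: sumr_ge0 => k _; exact: sqnorm_ge0. Qed.

Lemma sqn_eq0 z : (sqn z == 0) = (z == 0).
Proof.
rewrite psumr_eq0; last by move=> k _; exact: sqnorm_ge0.
apply/allP/eqP => [z0|-> k _]; last by rewrite /= mxE sqnorm_eq0.
apply/colP => k; rewrite mxE; apply/eqP; rewrite -sqnorm_eq0.
by apply: z0; rewrite mem_index_enum.
Qed.

Lemma sqnZ l z : sqn (l *: z) = sqnorm l * sqn z.
Proof.
by rewrite /sqn mulr_sumr; apply: eq_bigr => k _; rewrite mxE sqnormM.
Qed.

Lemma sqn_gt0 z : z != 0 -> 0 < sqn z.
Proof. by rewrite -sqn_eq0 lt_def sqn_ge0 andbT. Qed.

Lemma inner_self_neq0 z : z != 0 -> inner z z != 0.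
Proof. by rewrite inner_self toC_eq0 sqn_eq0. Qed.

Lemma hermsymmxP A : A \is hermsymmx -> map_mx Num.conj A^T = A.
Proof.
by move=> /is_hermitianmxP; rewrite expr0 scale1r => {2}->.
Qed.

Lemma reC_div l a : reC (l / toC a) = reC l / a.
Proof. by rewrite -toCV mulrC reCMl mulrC. Qed.

End HermitianProduct.

(** * Rayleigh quotients and the Fubini-Study form *)

Section Rayleigh.
Context {R : realType} {n : nat}.
Implicit Types (z v w : 'cV[Cx R]_n.+1) (A B : 'M[Cx R]_n.+1).

Definition rayleigh A z : R := reC (inner z (A *m z) / inner z z).

Lemma fubini_studyE z v w : fubini_study z v w =
  4 * (reC (inner z z * inner v w - inner v z * inner z w) / sqn z ^+ 2).
Proof.
by rewrite /fubini_study [in X in _ / X]inner_self -rmorphXn reC_div.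
Qed.

(** The form sees tangent vectors only modulo the base vector, and the denominator cancels a common
    rescaling. This makes chart changes and unitary maps comparable. *)
Lemma fubini_study_eq z v w z' v' w' (a b c : Cx R) : c != 0 -> z' = c *: z ->
  v' = c *: v + a *: z -> w' = c *: w + b *: z ->
  fubini_study z' v' w' = fubini_study z v w.
Proof.
move=> c0 -> -> ->; rewrite /fubini_study; congr (4 * reC _).
rewrite !(innerDl, innerDr, innerZl, innerZr).
have [->|z0] := eqVneq z 0.
  have i0 u : inner 0 u = 0 :> Cx R by rewrite /inner big1// => k _;
    rewrite mxE rmorph0 mul0r.
  by rewrite !i0 !(mul0r, mulr0, addr0, expr0n, subr0, oppr0, invr0).
have s0 := inner_self_neq0 z0.
have c0' : c^* != 0 by rewrite conjC_eq0.
field; by rewrite s0 c0 c0'.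
Qed.

Lemma fubini_study_unitary A z v w : map_mx Num.conj A^T *m A = 1%:M ->
  fubini_study (A *m z) (A *m v) (A *m w) = fubini_study z v w.
Proof.
by move=> AA; rewrite /fubini_study !inner_adj !mulmxA AA !mul1mx.
Qed.

Lemma reC_inner_sym z w : reC (inner z w) = reC (inner w z).
Proof. by rewrite -inner_conj reC_conj. Qed.

Lemma rayleighE A z : rayleigh A z = reC (inner z (A *m z)) / sqn z.
Proof. by rewrite /rayleigh inner_self reC_div. Qed.

Lemma fubini_study_sym z v w : fubini_study z v w = fubini_study z w v.
Proof.
rewrite !fubini_studyE -[in LHS]reC_conj; congr (4 * (reC _ / _)).
by rewrite rmorphB !rmorphM /= !inner_conj; ring.
Qed.

Lemma inner_herm_real A z : map_mx Num.conj A^T = A ->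
  inner z (A *m z) = toC (reC (inner z (A *m z))).
Proof.
move=> hA; apply: eqCx; rewrite ?reC_toC ?imC_toC//.
have : (inner z (A *m z))^* = inner z (A *m z).
  by rewrite inner_conj inner_adj hA.
move=> /(congr1 (@imC R)); rewrite imC_conj => /eqP.
by rewrite eq_sym -addr_eq0 -mulr2n mulrn_eq0 => /eqP.
Qed.

(** Along a real line numerator and denominator are real quadratic polynomials in [t], so the
    quotient rule at 0 suffices. The factor [2^-1] compares the 2 from differentiating a square with
    the 4 in [fubini_study]. *)
Lemma is_derive_rayleigh A z v : A \is hermsymmx -> z != 0 ->
  is_derive (0 : R) 1 (fun t => rayleigh A (z + toC t *: v))
    (2^-1 * fubini_study z (A *m z) v).
Proof.
move=> /hermsymmxP hA z0.
pose N t := reC (inner z (A *m z)) + (2 * reC (inner (A *m z) v)) * t +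
   reC (inner v (A *m v)) * (t * t).
pose D t := sqn z + (2 * reC (inner z v)) * t + sqn v * (t * t).
have E : (fun t => rayleigh A (z + toC t *: v)) = (fun t => N t / D t).
  apply/funext => t; rewrite rayleighE; congr (_ / _).
    rewrite mulmxDr -scalemxAr !(innerDl, innerDr, innerZl, innerZr) conj_toC.
    rewrite !raddfD /= !reCMl [inner z (A *m v)]inner_adj hA.
    by rewrite [reC (_ + _)]raddfD /= reCMl (reC_inner_sym v (A *m z)) /N; ring.
  rewrite -[LHS]reC_toC -inner_self !(innerDl, innerDr, innerZl, innerZr)
    conj_toC.
  rewrite !raddfD /= !reCMl.
  by rewrite !inner_self !reC_toC (reC_inner_sym v z) /D; ring.
rewrite {}E.
have quad (a b c : R) : is_derive (0 : R) 1 (fun t => a + b * t + c * (t * t))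
  b.
  have i := is_derive_id (0 : R) 1.
  have d := is_derive_add (is_derive_add (is_derive_cst a (0 : R) 1)
    (is_derive_mull b i))
    (is_derive_mull c (is_derive_mul i i)).
  by apply: is_derive_eq d _; ring.
have D0 : D 0 = sqn z by rewrite /D !mulr0 !addr0.
have D00 : D 0 != 0 by rewrite D0 sqn_eq0.
apply: is_derive_eq (is_derive_div D00 (quad _ _ _) (quad _ _ _)) _.
rewrite D0 !mulr0 !addr0 fubini_studyE inner_self raddfB /= reCMl.
have -> : reC (inner (A *m z) z * inner z v) =
   reC (inner z (A *m z)) * reC (inner z v).
  by rewrite -{1}hA -inner_adj (inner_herm_real z hA) reCMl reC_toC.
have s0 : sqn z != 0 by rewrite sqn_eq0.
by field.
Qed.

Lemma fubini_study_grad A B z : A \is hermsymmx -> B \is hermsymmx -> z != 0 ->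
  fubini_study z (A *m z) (B *m z) =
  4 * (rayleigh (A *m B) z - rayleigh A z * rayleigh B z).
Proof.
move=> /hermsymmxP hA /hermsymmxP hB z0.
have s0 : sqn z != 0 by rewrite sqn_eq0.
have -> : fubini_study z (A *m z) (B *m z) =
    4 * (reC (inner z z * inner z (A *m (B *m z)) -
      inner z (A *m z) * inner z (B *m z)) / sqn z ^+ 2).
  by rewrite fubini_studyE !(inner_adj A) hA.
rewrite (inner_herm_real z hA) (inner_herm_real z hB) inner_self raddfB /=
  !reCMl ?reC_toC !rayleighE mulmxA.
by field.
Qed.

(** Equality in Cauchy-Schwarz makes [v] a multiple of [z], and the coordinate [k] forces this
    multiple to be 0. *)
Lemma fubini_study_definite (k : 'I_n.+1) z v : z k 0 != 0 -> v k 0 = 0 ->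
  fubini_study z v v = 0 -> v = 0.
Proof.
move=> zk vk; have z0 : z != 0 by apply: contraNneq zk => ->; rewrite mxE.
have s0 : sqn z != 0 by rewrite sqn_eq0.
rewrite fubini_studyE => /eqP; rewrite mulf_eq0 pnatr_eq0 /= mulf_eq0 invr_eq0.
rewrite expf_eq0 (negPf s0) andbF orbF => /eqP h.
(* [u] is [inner z z] times the component of [v] orthogonal to [z]; its squared norm is [inner z z]
   times the numerator of the form. *)
pose u := inner z z *: v - inner z v *: z.
have uu : inner u u = inner z z * (inner z z * inner v v - inner v z * inner z
  v).
  rewrite /u !(innerBl, innerBr, innerZl, innerZr) !inner_conj !inner_self.
  by ring.
have u0 : u = 0.
  apply/eqP; rewrite -sqn_eq0; apply/eqP.
  by rewrite -[LHS]reC_toC -inner_self uu inner_self reCMl -inner_self h mulr0.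
have zv0 : inner z v = 0.
  have := congr1 (fun u : 'cV_n.+1 => u k 0) u0.
  rewrite !mxE vk mulr0 add0r => /eqP; rewrite oppr_eq0 mulf_eq0 (negPf zk)
    orbF.
  by move=> /eqP.
apply/eqP; have := u0; rewrite /u zv0 scale0r subr0 => /eqP.
by rewrite scaler_eq0 (negPf (inner_self_neq0 z0)).
Qed.

End Rayleigh.

(** * Complex differentials along real lines *)

Section DirectionalDerivative.
Context {R : realType}.

Lemma near_line m (y v : 'cV[Cx R]_m) (P : set 'cV[Cx R]_m) :
  nbhs y P -> \forall t \near (0 : R), P (y + toC t *: v).
Proof.
move=> yP; have c : (y + toC t *: v) @[t --> (0 : R)] --> y.
  rewrite -[X in _ --> X]addr0 -[X in _ + X](scale0r v).
  apply: cvgD; first exact: cvg_cst.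
  apply: cvgZ; last exact: cvg_cst.
  exact: (@toC_continuous R 0).
exact: c.
Qed.

Lemma is_derive_re_line n m (g : 'cV[Cx R]_n -> 'cV[Cx R]_m) z v k :
  differentiable g z ->
  is_derive (0 : R) 1 (fun t => reC (g (z + toC t *: v) k 0))
    (reC ('d g z v k 0)).
Proof.
move=> dg; have := @diff_derivable _ _ _ g z v dg.
have := @deriveE _ _ _ g z v dg.
move=> dE /cvg_ex[l hl].
have ld : l = 'd g z v by rewrite -dE; apply/esym; exact: cvg_lim hl.
rewrite {}ld in hl.
apply: cvg_is_derive.
(* [toC] is injective, hence respects punctured neighbourhoods, and the complex difference quotient
   can be restricted to real increments. *)
have c1 : toC t @[t --> (0 : R)^'] --> (0 : Cx R)^'.
  move=> P hP; have h := @toC_continuous R 0 _ hP.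
  have {}h : \forall t \near (0 : R), toC t != 0 -> P (toC t) := h.
  suff : \forall t \near (0 : R), t != 0 -> P (toC t) by [].
  by near=> t => t0; have := near h t; rewrite toC_eq0 => /(_ _ t0); apply.
have c2 := cvg_comp _ _ c1 hl.
have c3 := cvg_comp _ _ c2 (@coord_continuous _ m 1 k 0 ('d g z v)).
have c4 := cvg_comp _ _ c3 (@reC_continuous R _).
apply: cvg_trans c4; apply: near_eq_cvg; near=> t => /=.
rewrite addr0 rmorph0 scale0r addr0 !mxE -toCV reCMl raddfB /=.
by rewrite [_ *: v + z]addrC.
Unshelve. all: end_near. Qed.

End DirectionalDerivative.

(** * The unit circle and the kernel of [cis] *)

Section Cis.
Context {R : realType}.
Implicit Types a b : R.

Lemma cisD a b : cis (a + b) = cis a * cis b :> Cx R.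
Proof.
by apply: eqCx; rewrite ?reCM ?imCM /cis /reC /imC /= ?cosD ?sinD //; ring.
Qed.

Lemma cis0 : cis 0 = 1 :> Cx R.
Proof. by apply: eqCx; rewrite /cis /reC /imC /= ?cos0 ?sin0. Qed.

Lemma sqnorm_cis a : sqnorm (cis a) = 1.
Proof. exact: cos2Dsin2. Qed.

Lemma cis_neq0 a : cis a != 0 :> Cx R.
Proof. by rewrite -sqnorm_eq0 sqnorm_cis oner_eq0. Qed.

Lemma cis_2pi : cis (2 * pi) = 1 :> Cx R.
Proof.
by rewrite mulrC mulr_natr; apply: eqCx; rewrite /cis /reC /imC /=
  ?cos2pi ?sin2pi.
Qed.

Lemma cis_2pi_nat (k : nat) : cis (2 * pi * k%:R) = 1 :> Cx R.
Proof.
elim: k => [|k IH]; first by rewrite mulr0 cis0.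
by rewrite -[k.+1]addn1 natrD mulrDr [_ * 1%:R]mulr1 cisD IH cis_2pi mulr1.
Qed.

Lemma cis_2pi_int (k : int) : cis (2 * pi * k%:~R) = 1 :> Cx R.
Proof.
case: k => k; first exact: cis_2pi_nat.
rewrite NegzE mulrNz mulrN; apply: (mulfI (cis_neq0 (2 * pi * k.+1%:R))).
by rewrite -cisD subrr cis0 mulr1 cis_2pi_nat.
Qed.

Lemma cis_eq1 (t : R) : cis (2 * pi * t) = 1 :> Cx R -> exists k : int,
  t = k%:~R.
Proof.
(* The fractional part [s] has to vanish. The cosine is injective on [[0, pi]], which contains
   [2 pi s] or else its reflection [2 pi (1 - s)]; the latter would give [s = 1]. *)
move=> ct; exists (Num.floor t); apply/eqP; rewrite -subr_eq0; apply/eqP.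
set s := t - _.
have s0 : 0 <= s by rewrite subr_ge0 floor_le_tmp.
have s1 : s < 1 by rewrite ltrBlDr addrC -[X in _ + X]/(1%:~R) -intrD1
  floorD1_gt.
have : cis (2 * pi * s) = 1 :> Cx R.
  apply: (mulfI (cis_neq0 (2 * pi * (Num.floor t)%:~R))).
  by rewrite -cisD -mulrDr addrC subrK cis_2pi_int mulr1.
move=> /(congr1 (@reC R)); rewrite /cis /reC /= => c1.
have p0 := pi_gt0 R.
have [h|h] := leP (2 * pi * s) pi.
  have : 2 * pi * s = 0.
    apply: cos_inj; rewrite ?in_itv /= ?c1 ?cos0// ?lexx ?(ltW p0)// h andbT.
    by rewrite !mulr_ge0// ltW.
  by move=> /eqP; rewrite !mulf_eq0 pnatr_eq0 /= (gt_eqF p0) => /eqP.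
have : 2 * pi * (1 - s) = 0.
  apply: cos_inj; rewrite ?in_itv /= ?cos0 ?lexx ?(ltW p0)//.
    by nra.
  have -> : 2 * pi * (1 - s) = - (2 * pi * s) + pi *+ 2 by rewrite -mulr_natr;
    ring.
  by rewrite cosD2pi cosN c1.
move=> /eqP; rewrite !mulf_eq0 pnatr_eq0 /= (gt_eqF p0) /= subr_eq0 => /eqP e.
by rewrite e ltxx in s1.
Qed.

End Cis.

(** * Homogeneous coordinates, affine charts and the free locus *)

Section Projective.
Context {R : realType} {n : nat}.
Implicit Types (z w : 'cV[Cx R]_n.+1) (x : projS R n).

Lemma proj_eqP z w : z != 0 -> w != 0 ->
  proj z = proj w <-> exists2 l : Cx R, l != 0 & w = l *: z.
Proof.
move=> z0 w0; split=> [/eqmodP/asboolP[l]|[l l0 ->]];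
  last by rewrite proj_scale.
rewrite !insubdK; [|exact/mem_set..] => wE; exists l => //.
by apply: contraNneq w0 => l0; rewrite wE l0 scale0r.
Qed.

Lemma proj_repr_neq0 x : proj_repr x != 0.
Proof. exact: nzvec_neq0. Qed.

Lemma proj_reprK x : proj (proj_repr x) = x.
Proof.
rewrite /proj /proj_repr.
by rewrite valKd reprK.
Qed.

Lemma insertE k a (w : 'cV[Cx R]_n) : insert k a w k 0 = a.
Proof. by rewrite mxE unlift_none. Qed.

Lemma insert_lift k a (w : 'cV[Cx R]_n) i : insert k a w (lift k i) 0 = w i 0.
Proof. by rewrite mxE liftK. Qed.

Lemma insertP k (u v : 'cV[Cx R]_n.+1) : u k 0 = v k 0 ->
  (forall i, u (lift k i) 0 = v (lift k i) 0) -> u = v.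
Proof.
by move=> uv uv'; apply/colP => j; case: (unliftP k j) => [i ->|->].
Qed.

Lemma insert1_neq0 k (w : 'cV[Cx R]_n) : insert k 1 w != 0.
Proof.
apply: contra_neq (oner_neq0 (Cx R)) => /colP/(_ k).
by rewrite insertE mxE.
Qed.

Lemma insert_line k a (y v : 'cV[Cx R]_n) (l : Cx R) :
  insert k a (y + l *: v) = insert k a y + l *: insert k 0 v.
Proof.
by apply: (@insertP k) => [|i]; rewrite !mxE ?unlift_none ?mulr0 ?addr0 //
  liftK !mxE.
Qed.

(** The base vector of a chart and the image of the chart's differential together span the whole
    space. *)
Lemma insert_decomp k (y : 'cV[Cx R]_n) w : w = w k 0 *: insert k 1 y +
  insert k 0 (\col_i (w (lift k i) 0 - w k 0 * y i 0)).
Proof.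
apply: (@insertP k) => [|i]; rewrite !mxE ?unlift_none ?liftK.
  by rewrite mulr1 addr0.
by rewrite mxE addrC subrK.
Qed.

(** The coordinates of [[z]] in the chart [k]. *)
Definition affine k z : 'cV[Cx R]_n := \col_i (z (lift k i) 0 / z k 0).

Lemma insert_affine k z : z k 0 != 0 -> insert k 1 (affine k z) = (z k 0)^-1 *:
  z.
Proof.
move=> zk; apply: (@insertP k) => [|i].
  by rewrite insertE mxE mulVf.
by rewrite insert_lift !mxE mulrC.
Qed.

Lemma nonzero_coord z : z != 0 -> exists k, z k 0 != 0.
Proof.
move=> z0; apply/existsP; apply: contraNT z0; rewrite negb_exists => /forallP h.
apply/eqP/colP => k; rewrite mxE; apply/eqP; have := h k; by rewrite negbK.
Qed.

Lemma proj_affine k z : z k 0 != 0 -> proj (insert k 1 (affine k z)) = proj z.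
Proof.
move=> zk; rewrite insert_affine// proj_scale ?invr_eq0//.
by apply: contraNneq zk => ->; rewrite mxE.
Qed.

Lemma near_neq0 z : z != 0 -> \forall w \near z, w != 0.
Proof.
move=> z0; have [k zk] := nonzero_coord z0.
have := @cvgr_neq0 _ _ _ (nbhs z) (nbhs_filter z) _ _ (@coord_continuous _ n.+1
  1 k 0 z) zk.
apply: (@filterS _ (nbhs z)) => w; apply: contraNneq => ->; by rewrite mxE.
Qed.

Lemma chartP x : exists k y, x = proj (insert k 1 y).
Proof.
have [k xk] := nonzero_coord (proj_repr_neq0 x).
by exists k, (affine k (proj_repr x)); rewrite proj_affine// proj_reprK.
Qed.

(** A vanishing coordinate leaves room for a half turn that fixes the point. If none vanishes, the
    last coordinate, on which the torus acts trivially, forces the scale factor to be 1. *)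
Lemma free_locusP z : z != 0 ->
  free_locus (proj_torus R n) (proj z) <-> (forall k, z k 0 != 0).
Proof.
move=> z0; pose tz (t : 'cV[R]_n) : 'cV[Cx R]_n.+1 :=
  \col_j (if unlift ord_max j is Some i then cis (2 * pi * t i 0) * z j 0 else z
    j 0).
have tz0 t : tz t != 0.
  have [k zk] := nonzero_coord z0; apply: contraNneq zk => /colP/(_ k).
  rewrite !mxE; case: unlift => [i /eqP|->//].
  by rewrite mulf_eq0 (negPf (cis_neq0 _)).
have cpi : cis (2 * pi * 2^-1) = -1 :> Cx R.
  by apply: eqCx; rewrite /cis /reC /imC /= mulrAC divff ?pnatr_eq0//
    mul1r ?cospi ?sinpi ?oppr0.
have half (k : int) : 2^-1 <> k%:~R :> R.
  move=> /(congr1 ( *%R^~ 2)); rewrite mulVf ?pnatr_eq0// -[2]/(2%:~R) -intrM.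
  by move=> /eqP; rewrite -[1]/(1%:~R) eqr_int; lia.
split=> [h k|h t].
  apply/negP => /eqP zk; case: (unliftP ord_max k) => [i ki|km].
    (* The half turn in the vanishing coordinate alone fixes [z]. *)
    have [] := h (\col_j (if j == i then 2^-1 else 0)).
      rewrite proj_torus_proj// -/(tz _); congr proj; apply/colP => j;
        rewrite mxE.
      case: unliftP => [l ->|//]; rewrite mxE; case: eqP => [->|_];
        last by rewrite mulr0 cis0 mul1r.
      by rewrite -ki zk mulr0.
    by move=> m /colP/(_ i); rewrite !mxE eqxx; exact: half.
  (* When the last coordinate vanishes, the half turn in all the others sends [z] to [- z]. *)
  have [] := h (\col_j 2^-1).
    rewrite proj_torus_proj// -/(tz _); apply/proj_eqP => //; exists (-1).
      by rewrite oppr_eq0 oner_eq0.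
    apply/colP => j; rewrite !mxE; case: unliftP => [l ->|->].
      by rewrite mxE cpi mulrA mulrNN !mul1r.
    by rewrite -km zk mulr0.
  move=> m /colP mE.
  (* Some coordinate other than the last is nonzero, so ['I_n] has an element at which 1/2 would be
     an integer. *)
  have [k' zk'] := nonzero_coord z0.
  case: (unliftP ord_max k') => [i _|k'm]; last by rewrite k'm -km zk eqxx
    in zk'.
  by have := mE i; rewrite !mxE; exact: half.
rewrite proj_torus_proj// -/(tz _) => /(proj_eqP (tz0 t) z0)[l l0 /colP zE].
have l1 : l = 1.
  have := zE ord_max; rewrite !mxE unlift_none => /eqP.
  by rewrite -subr_eq0 -{1}[z _ _]mul1r -mulrBl mulf_eq0 (negPf (h _)) orbF
    subr_eq0 => /eqP.
have c i : exists k : int, t i 0 = k%:~R.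
  apply: cis_eq1; have := zE (lift ord_max i); rewrite !mxE liftK l1 mul1r =>
    /eqP.
  by rewrite -subr_eq0 -{1}[z _ _]mul1r -mulrBl mulf_eq0 (negPf (h _)) orbF
    subr_eq0 => /eqP.
have [f fE] := choice c.
by exists (\col_i f i); apply/colP => i; rewrite !mxE fE.
Qed.

Lemma free_insert k (y : 'cV[Cx R]_n) :
  free_locus (proj_torus R n) (proj (insert k 1 y)) <-> (forall i, y i 0 != 0).
Proof.
split=> [/(free_locusP (insert1_neq0 _ _)) h i|h].
  by have := h (lift k i); rewrite insert_lift.
apply/(free_locusP (insert1_neq0 _ _)) => j.
by case: (unliftP k j) => [i ->|->]; rewrite ?insert_lift// insertE oner_eq0.
Qed.

Lemma near_free k (y : 'cV[Cx R]_n) :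
  free_locus (proj_torus R n) (proj (insert k 1 y)) ->
  \forall u \near y, free_locus (proj_torus R n) (proj (insert k 1 u)).
Proof.
move=> /free_insert h.
have : \forall u \near y, forall i, (u : 'cV[Cx R]_n) i 0 != 0.
  apply: (@filter_forall _ _ (fun i (u : 'cV[Cx R]_n) => u i 0 != 0)
    (nbhs y)) => i.
  have := @coord_continuous _ n 1 i 0 y.
  by move=> /cvgr_neq0 -/(_ (h i)).
by apply: filterS => u hu; apply/free_insert.
Qed.

End Projective.

(** * From local isometries to the spectrum of [H] *)

Section Uniqueness.
Context {R : realType} {n : nat}.
Implicit Types (z v w : 'cV[Cx R]_n.+1) (y : 'cV[Cx R]_n) (A B H :
  'M[Cx R]_n.+1).
Implicit Types (X Z : 'I_n.+1 -> R).

Local Notation free := (free_locus (proj_torus R n)).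
Local Notation chart k y := (proj (insert k 1 y)).

(* The Fubini-Study form at [z] does not see multiples of [z], so that every
   vector can be moved into the image of the differential of a chart. *)
Lemma fubini_study_chart k y v w :
  fubini_study (insert k 1 y) v w =
  fubini_study (insert k 1 y) v
    (insert k 0 (\col_i (w (lift k i) 0 - w k 0 * y i 0))).
Proof.
apply/esym; apply: (@fubini_study_eq _ _ _ _ _ _ _ _ 0 (- w k 0) 1).
- exact: oner_neq0.
- by rewrite scale1r.
- by rewrite scale1r scale0r addr0.
- rewrite scale1r; apply: (@insertP _ _ k) => [|i].
    by rewrite insertE !mxE unlift_none mulr1 subrr.
  by rewrite insert_lift !mxE liftK mulNr.
Qed.

Section Chart.
Variables (k : 'I_n.+1) (y0 : 'cV[Cx R]_n) (h : 'cV[Cx R]_n -> 'cV[Cx R]_n).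
Hypothesis dh : differentiable h y0.
Hypothesis iso : forall v w : 'cV[Cx R]_n, tangent_metric (simplex R n) (h y0)
  ('d h y0 v) ('d h y0 w) =
  fubini_study (insert k 1 y0) (insert k 0 v) (insert k 0 w).
Local Notation z := (insert k 1 y0).

(* Definiteness of the Fubini-Study form makes the differential injective. *)
Lemma isometric_diff_surj c : exists v : 'cV[Cx R]_n, 'd h y0 v = c.
Proof.
pose L := linfun ('d h y0).
have Linj : lker L == 0%VS.
  apply/lker0P => a b; rewrite !lfunE /= => ab; apply/eqP; rewrite -subr_eq0.
  have d0 : 'd h y0 (a - b) = 0 by rewrite linearB /= ab subrr.
  have : insert k 0 (a - b) = 0.
    apply: (@fubini_study_definite _ _ k z).
    - by rewrite insertE oner_eq0.
    - by rewrite insertE.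
    - rewrite -iso d0 /tangent_metric big1// => i _; rewrite big1// => j _.
      by rewrite !mxE !raddf0 !mulr0 addr0 mulr0.
  move=> ins0; apply/eqP/colP => i.
  by have := congr1 (fun u : 'cV_n.+1 => u (lift k i) 0) ins0;
    rewrite insert_lift !mxE.
by exists ((L^-1)%VF c); rewrite -[LHS]lfunE; exact: (lker0_lfunVK Linj).
Qed.

(** Both sides of the local identity are differentiated at [t = 0] along [y0 + t v]; each derivative
    is the pairing with a gradient. *)
Lemma diff_rayleigh A X (v : 'cV[Cx R]_n) : A \is hermsymmx ->
  (\forall y \near y0, rayleigh A (insert k 1 y) =
     expect (simplex R n (re_vec (h y))) X) ->
  tangent_metric (simplex R n) (h y0) (obs_coef X) ('d h y0 v) =
  2^-1 * fubini_study z (A *m z) (insert k 0 v).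
Proof.
move=> hA /(near_line v) eqn.
have d1 := is_derive_rayleigh (insert k 0 v) hA (insert1_neq0 k y0).
have d2 : is_derive (0 : R) 1
   (fun t => expect (simplex R n (re_vec (h (y0 + toC t *: v)))) X)
   (tangent_metric (simplex R n) (h y0) (obs_coef X) ('d h y0 v)).
  apply: (@is_derive_expect _ _ (fun t => re_vec (h (y0 + toC t *: v)))) =>
    [|i].
    by rewrite rmorph0 scale0r addr0.
  have := is_derive_re_line v i dh.
  congr (is_derive _ _ _ _).
  by apply/funext => t; rewrite mxE.
have e := @near_eq_derive _ _ _ (fun t => rayleigh A (z + toC t *:
  insert k 0 v)) _ (0 : R) 1 _.
rewrite -[RHS](@derive_val _ _ _ _ _ _ _ d1) -[LHS](@derive_val _ _ _ _ _ _ _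
  d2).
apply/esym/e; apply: filterS eqn => t /= <-.
by rewrite insert_line.
Qed.

(** The isometry identifies the gradients on the two sides, hence their pairings: covariance of [X]
    and [Z] on one side, [f_(A B) - f_A f_B] on the other. The products of the means cancel. *)
Lemma expect_mul A B X Z : A \is hermsymmx -> B \is hermsymmx ->
  (\forall y \near y0, rayleigh A (insert k 1 y) =
     expect (simplex R n (re_vec (h y))) X) ->
  (\forall y \near y0, rayleigh B (insert k 1 y) =
     expect (simplex R n (re_vec (h y))) Z) ->
  rayleigh (A *m B) z =
  expect (simplex R n (re_vec (h y0))) (fun x => X x * Z x).
Proof.
move=> hA hB AX BZ.
(* [a] and [b] are the chart vectors sent to the two Fisher gradients; by [TA] and [TB] they
   represent half of [A z] and half of [B z] modulo [z]. *)
have [a aE] := isometric_diff_surj (obs_coef X).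
have [b bE] := isometric_diff_surj (obs_coef Z).
have TA (v : 'cV[Cx R]_n) : fubini_study z (insert k 0 a) (insert k 0 v) =
    2^-1 * fubini_study z (A *m z) (insert k 0 v).
  by rewrite -iso aE; exact: diff_rayleigh.
have TB (v : 'cV[Cx R]_n) : fubini_study z (insert k 0 b) (insert k 0 v) =
    2^-1 * fubini_study z (B *m z) (insert k 0 v).
  by rewrite -iso bE; exact: diff_rayleigh.
have : tangent_metric (simplex R n) (h y0) (obs_coef X) (obs_coef Z) =
    4^-1 * fubini_study z (A *m z) (B *m z).
  (* [TB] applies to chart vectors only, so [A z] is moved into the chart along [z] and back
     afterwards. *)
  rewrite -aE -bE iso TA fubini_study_sym (fubini_study_chart k y0 _ (A *m z))
    TB.
  by rewrite -fubini_study_chart fubini_study_sym mulrA; congr (_ * _); field.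
rewrite tangent_metric_obs (fubini_study_grad hA hB (insert1_neq0 _ _)) mulKf
  ?pnatr_eq0//.
rewrite (nbhs_singleton AX) (nbhs_singleton BZ).
by move=> /(addIr _).
Qed.

End Chart.

Lemma hermsymmx_exp A m : A \is hermsymmx -> A ^+ m \is hermsymmx.
Proof.
move=> /hermsymmxP hA; apply/is_hermitianmxP; rewrite expr0 scale1r.
elim: m => [|m IH]; first by rewrite expr0 trmx1 map_mx1.
by rewrite {1}exprSr exprS -!/(mulmx _ _) trmx_mul map_mxM /= -IH hA.
Qed.

(** Expanding both sides over pairs of coefficients leaves the pairing of [A^i z] with [A^j z],
    which is the moment of order [i + j] as [A] is Hermitian. *)
Lemma poly_moment A z X (q : 'I_n.+1 -> R) (P : {poly Cx R}) :
  A \is hermsymmx ->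
  (forall m, inner z (A ^+ m *m z) = \sum_x toC (q x) * toC (X x) ^+ m) ->
  inner (horner_mx A P *m z) (horner_mx A P *m z) =
  \sum_x toC (q x * sqnorm P.[toC (X x)]).
Proof.
move=> hA mom.
have hP : horner_mx A P *m z = \sum_(i < size P) P`_i *: (A ^+ i *m z).
  rewrite -[in LHS](coefK P) poly_def rmorph_sum /= mulmx_suml.
  apply: eq_bigr => i _; rewrite linearZ /= rmorphXn /= horner_mx_X.
  by rewrite scalemxAl.
rewrite {}hP inner_suml.
under eq_bigr do rewrite inner_sumr.
under [RHS]eq_bigr do rewrite rmorphM /= -conj_mul horner_coef rmorph_sum
  mulr_suml mulr_sumr.
rewrite [RHS]exchange_big; apply: eq_bigr => i _ /=.
under [RHS]eq_bigr do rewrite !mulr_sumr.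
rewrite [RHS]exchange_big; apply: eq_bigr => j _ /=.
rewrite innerZl innerZr.
have -> : inner (A ^+ i *m z) (A ^+ j *m z) = inner z (A ^+ (i + j) *m z).
  rewrite -{1}(hermsymmxP (hermsymmx_exp i hA)) -inner_adj mulmxA.
  by rewrite exprD.
rewrite mom !mulr_sumr; apply: eq_bigr => x _.
rewrite rmorphM /= rmorphXn /= conj_toC exprD; ring.
Qed.

Variables (phi : projS R n -> projS R n) (K : projS R n -> 'I_n.+1 -> R).
Variables (H : 'M[Cx R]_n.+1) (X : 'I_n.+1 -> R).
Hypothesis hH : H \is hermsymmx.
Hypothesis phi_surj : forall x, exists x', phi x' = x.
(** [h] stands for [phi] followed by the inverse of the torification, read in charts. *)
Hypothesis local : forall k y0, free (phi (chart k y0)) ->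
  exists h : 'cV[Cx R]_n -> 'cV[Cx R]_n,
  [/\ differentiable h y0,
   forall v w : 'cV[Cx R]_n, tangent_metric (simplex R n) (h y0) ('d h y0 v)
     ('d h y0 w) =
     fubini_study (insert k 1 y0) (insert k 0 v) (insert k 0 w),
   \forall y \near y0, free (phi (chart k y)) &
   \forall y \near y0, K (phi (chart k y)) = simplex R n (re_vec (h y))].
Hypothesis fE : forall x, fH H x = expect (K (phi x)) X.

(** The induction runs over all free points at once, because [expect_mul] differentiates the
    identity for [m] and so requires it on a neighbourhood. *)
Lemma rayleigh_moment m k y : free (phi (chart k y)) ->
  rayleigh (H ^+ m) (insert k 1 y) =
  expect (K (phi (chart k y))) (fun x => X x ^+ m).
Proof.
elim: m k y => [|m IH] k y fr; have [h [dh iso nfr Kh]] := local fr.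
  rewrite rayleighE expr0 mul1mx inner_self reC_toC divff ?sqn_eq0
    ?insert1_neq0//.
  rewrite (nbhs_singleton Kh) /expect -(sum_simplex (re_vec (h y))).
  by apply: eq_bigr => x _; rewrite expr0 mul1r.
rewrite (nbhs_singleton Kh) exprS.
rewrite (@expect_mul k y h dh iso H (H ^+ m) X (fun x => X x ^+ m)) //.
- by congr expect; apply/funext => x; rewrite exprS.
- exact: hermsymmx_exp.
- near=> u; rewrite -(near Kh u)// -fE fH_proj ?insert1_neq0//.
- near=> u; rewrite -(near Kh u)// IH//; near: u; exact: nfr.
Unshelve. all: end_near. Qed.

(** The weights are [|z|^2] times a point of the open simplex. Their strict positivity makes the
    left side vanish exactly when [P] vanishes at every value of [X]. *)
Lemma poly_free (P : {poly Cx R}) k y : free (phi (chart k y)) ->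
  exists2 p : 'I_n.+1 -> R, (forall x, 0 < p x) &
  inner (horner_mx H P *m insert k 1 y) (horner_mx H P *m insert k 1 y) =
    \sum_x toC (p x * sqnorm P.[toC (X x)]).
Proof.
move=> fr; have [h [dh iso nfr Kh]] := local fr; set z := insert k 1 y.
exists (fun x => sqn z * simplex R n (re_vec (h y)) x).
  by move=> x; rewrite mulr_gt0 ?simplex_gt0// sqn_gt0// insert1_neq0.
apply: poly_moment => // m.
have s0 : sqn z != 0 by rewrite sqn_eq0 insert1_neq0.
rewrite (inner_herm_real _ (hermsymmxP (hermsymmx_exp m hH))).
have := rayleigh_moment m fr; rewrite rayleighE -/z => /(canRL (divfK s0)) ->.
rewrite (nbhs_singleton Kh) /expect mulr_suml rmorph_sum; apply: eq_bigr =>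
  x _ /=.
by rewrite -rmorphXn -rmorphM; congr toC; ring.
Qed.

Lemma spectrum_unique : [set toC (X x) | x in [set: 'I_n.+1]] = spec_mx H.
Proof.
have [k [y0 fr]] : exists k y, free (phi (chart k y)).
  have [x' x'E] := phi_surj (proj (const_mx 1)).
  have [k [y yE]] := chartP x'; exists k, y; rewrite -yE x'E.
  have o0 : const_mx 1 != 0 :> 'cV[Cx R]_n.+1.
    by apply: contra_neq (oner_neq0 (Cx R)) => /colP/(_ ord0); rewrite !mxE.
  by apply/free_locusP => // j; rewrite mxE oner_eq0.
apply/seteqP; split=> [_ [x _ <-]|a].
  rewrite /spec_mx /= eigenvalue_root_min.
  (* The minimal polynomial kills the left side, so positivity of the weights makes each [X x] one
     of its roots. *)
  have [p p0] := poly_free (mxminpoly H) fr.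
  rewrite mx_root_minpoly mul0mx.
  have -> : inner (0 : 'cV[Cx R]_n.+1) 0 = toC 0.
    by rewrite inner_self; congr toC; apply/eqP; rewrite sqn_eq0.
  rewrite -rmorph_sum => /toC_inj/esym/eqP; rewrite psumr_eq0; last first.
    by move=> i _; rewrite mulr_ge0 ?sqnorm_ge0// ltW.
  move=> /allP/(_ x); rewrite mem_index_enum => /(_ isT) /=.
  by rewrite mulf_eq0 (gt_eqF (p0 x)) /= sqnorm_eq0.
rewrite /spec_mx /= eigenvalue_root_min => ra.
(* Conversely [P] kills the right side, so [P(H)] vanishes on a set of vectors that spans. The
   minimal polynomial then divides [P]. *)
pose P : {poly Cx R} := \prod_(x : 'I_n.+1) ('X - (toC (X x))%:P).
have PX x : P.[toC (X x)] = 0.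
  by apply/rootP; rewrite /P (bigD1 x) //= rootM root_XsubC eqxx.
have Pk y : free (phi (chart k y)) -> horner_mx H P *m insert k 1 y = 0.
  move=> /(poly_free P)[p p0].
  rewrite inner_self big1; last first.
    by move=> x _; rewrite PX (_ : sqnorm 0 = 0) ?mulr0// /sqnorm raddf0 raddf0
      expr0n addr0.
  by move=> /eqP; rewrite toC_eq0 sqn_eq0 => /eqP.
have PH : horner_mx H P = 0.
  have [h [dh iso nfr Kh]] := local fr.
  (* [P(H)] vanishes at [y0] and at a nearby point [y0 + t v] with [t] nonzero, hence on the
     difference. *)
  have P0 (v : 'cV[Cx R]_n) : horner_mx H P *m insert k 0 v = 0.
    have [t [t0]] : exists t : R, t != 0 /\ free (phi (chart k (y0 + toC t *:
      v))).
      have /= := @filter_ex _ (0 : R)^' _ _ (filterI (nbhs_dnbhs_neq 0)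
        (nbhs_dnbhs (near_line v nfr))).
      by move=> [t [t0 ft]]; exists t.
    move=> /Pk; rewrite insert_line mulmxDr (Pk _ fr) add0r -scalemxAr => /eqP.
    by rewrite scaler_eq0 toC_eq0 (negPf t0) => /eqP.
  apply/matrixP => i j; rewrite mxE.
  have : horner_mx H P *m delta_mx j 0 = 0 :> 'cV_n.+1.
    rewrite (insert_decomp k y0 (delta_mx j 0)).
    by rewrite mulmxDr P0 -scalemxAr (Pk _ fr) scaler0 addr0.
  by rewrite -colE => /colP/(_ i); rewrite !mxE.
have /dvdpP[Q PQ] := mxminpoly_min PH.
have /rootP : root P a by rewrite PQ rootM ra orbT.
rewrite /P horner_prod => /eqP/prodf_eq0[x _]; rewrite hornerXsubC subr_eq0 =>
  /eqP ->.
by exists x.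
Qed.

End Uniqueness.

(** The hypothesis [local] of [spectrum_unique] is met by [g2 \o g1], where [g1] reads [phi] and
    [g2] reads the inverse of [G] in charts. *)
Lemma is_spectrum_unique (R : realType) n (H : 'M[Cx R]_n.+1) (S : set R) :
  H \is hermsymmx ->
  is_spectrum (simplex R n) (proj_torus R n) (simplexF R n) (fH H) S ->
  [set toC a | a in S] = spec_mx H.
Proof.
move=> hH [K [phi [X [[kappa [[Y [G [_ [bijG _ [Ginv [GinvK holGinv]]] _ Gk]]]
  Kk _ _]]]]]].
(* A member of the identity component is itself a holomorphic isometry. *)
move=> /connected_component_sub[[_ _ surj_phi] hol_phi _] _ fE ->.
have GK x : free_locus (proj_torus R n) x -> G (Ginv x) = x.
  case: bijG => _ _ surjG /surjG[u _ <-]; by rewrite GinvK.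
rewrite -(@spectrum_unique _ _ phi K H X hH)//.
- by rewrite image_comp.
- by move=> x; have [x' _ <-] := surj_phi x I; exists x'.
move=> k y0 fr.
have [j [g1 [near1 dg1 iso1]]] := hol_phi k y0 I I.
have e1 := nbhs_singleton near1.
have fr1 : free_locus (proj_torus R n) (proj (insert j 1 (g1 y0))).
  by rewrite -[proj _]e1.2.
have [U [g2 [near2 dg2 iso2]]] := holGinv j (g1 y0) I fr1.
have dcomp := @differentiable_comp _ _ _ _ g1 g2 y0 dg1 dg2.
have c1 := differentiable_continuous dg1.
have FF : Filter (nbhs y0) := nbhs_filter y0.
have nfree : \forall y \near y0, free_locus (proj_torus R n)
  (phi (proj (insert k 1 y))).
  have := c1 _ (near_free fr1) => /= c1'.
  near=> y; have -> : phi (proj (insert k 1 y)) = proj (insert j 1 (g1 y)).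
    by have [] := near near1 y.
  by near: y.
exists (g2 \o g1); split => //.
- move=> v w; rewrite (@diff_comp _ _ _ _ g1 g2 y0 dg1 dg2).
  exact: etrans (iso2 ('d g1 y0 v) ('d g1 y0 w)) (iso1 v w).
- have c2 : \forall y \near y0,
      Ginv (proj (insert j 1 (g1 y))) = qL Y (g2 (g1 y)).
    have := c1 _ near2; rewrite /= nbhs_simpl /=.
    by apply: (@filterS _ (nbhs y0)) => y [].
  near=> y.
  have fy : free_locus (proj_torus R n) (phi (proj (insert k 1 y))) by near: y.
  rewrite Kk//; move: fy.
  have -> : phi (proj (insert k 1 y)) = proj (insert j 1 (g1 y)).
    by have [] := near near1 y.
  move=> fy; rewrite -(GK _ fy).
  have -> : Ginv (proj (insert j 1 (g1 y))) = qL Y (g2 (g1 y)).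
    by have := near c2 y; apply.
  exact: Gk.
Unshelve. all: end_near. Qed.

(** * The complex exponential and its local inverses *)

Section ComplexExponential.
Context {R : realType}.
Implicit Types (z w : Cx R).

Definition cexp z : Cx R := toC (expR (reC z)) * cis (imC z).

Lemma cexpD z w : cexp (z + w) = cexp z * cexp w.
Proof. by rewrite /cexp !raddfD /= expRD cisD rmorphM /=; ring. Qed.

Lemma cexp0 : cexp 0 = 1.
Proof. by rewrite /cexp !raddf0 expR0 cis0 rmorph1 mulr1. Qed.

Lemma cexp_neq0 z : cexp z != 0.
Proof. by rewrite mulf_neq0 ?cis_neq0// toC_eq0 gt_eqF// expR_gt0. Qed.

Lemma sqnorm_cexp z : sqnorm (cexp z) = expR (reC z) ^+ 2.
Proof.
by rewrite /cexp sqnormM sqnorm_cis mulr1 /sqnorm reC_toC imC_toC expr0n addr0.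
Qed.

Lemma reC_cexp z : reC (cexp z) = expR (reC z) * cos (imC z).
Proof. by rewrite /cexp reCMl. Qed.

Lemma imC_cexp z : imC (cexp z) = expR (reC z) * sin (imC z).
Proof. by rewrite /cexp imCMl. Qed.

(** The difference quotient at 0, given the value [d] at 0 so that it is continuous there when [d]
    is the derivative. *)
Definition slope (f : R -> R) (d : R) (x : R) : R :=
  if x == 0 then d else x^-1 * (f x - f 0).

Lemma slopeP (f : R -> R) (d : R) x : f x - f 0 = x * slope f d x.
Proof.
rewrite /slope; have [->|x0] := eqVneq x 0; first by rewrite subrr mul0r.
by rewrite mulrA divff// mul1r.
Qed.

Lemma slope_cvg (f : R -> R) (d : R) : is_derive (0 : R) 1 f d ->
  slope f d x @[x --> (0 : R)] --> d.
Proof.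
case=> df dE.
have h : x^-1 * (f x - f 0) @[x --> (0 : R)^'] --> d.
  rewrite -dE; apply: cvg_trans df; apply: near_eq_cvg; near=> x.
  by rewrite /= addr0 [x%:A]mulr1.
apply/cvgrPdist_lt => e e0; move/cvgrPdist_lt : h => /(_ e e0).
rewrite near_withinE => h; near=> x; rewrite /slope; case: eqVneq => [_|x0].
  by rewrite subrr normr0.
by move: x0; near: x.
Unshelve. all: end_near. Qed.

Lemma cexp_slope : h^-1 * (cexp h - 1) @[h --> (0 : Cx R)^'] --> (1 : Cx R).
Proof.
pose a := slope (@expR R) 1; pose b := slope (@sin R) 1;
  pose c := slope (@cos R) 0.
have ac : a x @[x --> (0 : R)] --> (1 : R).
  by apply: slope_cvg; rewrite -[X in is_derive _ _ _ X]expR0;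
    exact: is_derive_expR.
have bc : b x @[x --> (0 : R)] --> (1 : R).
  by apply: slope_cvg; rewrite -[X in is_derive _ _ _ X]cos0;
    exact: is_derive_sin.
have cc : c x @[x --> (0 : R)] --> (0 : R).
  apply: slope_cvg; rewrite -[X in is_derive _ _ _ X]oppr0 -[X in is_derive _ _
    _ (- X)]sin0.
  exact: is_derive_cos.
(* For [h = x + i y], the real and imaginary parts of [cexp h - 1 - h] are
   [x (a x cos y - 1) + y c y] and [y (expR x * b y - 1)]. Bounding [|x|] and [|y|] by [|h|] leaves
   the factor [e1], which tends to 0. *)
pose e1 (x y : R) := `|a x * cos y - 1| + `|c y| + `|expR x * b y - 1|.
have bound (h : Cx R) : h != 0 ->
    `|h^-1 * (cexp h - 1) - 1| <= toC (e1 (reC h) (imC h)).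
  move=> h0; set x := reC h; set y := imC h.
  have -> : h^-1 * (cexp h - 1) - 1 = h^-1 * (cexp h - 1 - h).
    by rewrite [RHS]mulrBr mulVf.
  rewrite normrM normfV ler_pdivrMl ?normr_gt0//.
  apply: (le_trans (norm_le_reim _)).
  have re : reC (cexp h - 1 - h) = x * (a x * cos y - 1) + y * c y.
    have -> : reC (cexp h - 1 - h) = expR x * cos y - 1 - x.
      by rewrite !reCB reC_cexp.
    have := slopeP (@expR R) 1 x; rewrite expR0 => /(canRL (subrK _)) ->.
    have := slopeP (@cos R) 0 y; rewrite cos0 -/c -/a => cE.
    by rewrite mulrBr mulrA -cE; ring.
  have im : imC (cexp h - 1 - h) = y * (expR x * b y - 1).
    have -> : imC (cexp h - 1 - h) = expR x * sin y - 0 - y.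
      by rewrite !imCB imC_cexp.
    have := slopeP (@sin R) 1 y; rewrite sin0 subr0 -/b => ->.
    by ring.
  rewrite re im /e1;
    apply: (@le_trans _ _ (toC (`|x| * `|a x * cos y - 1| + `|y| * `|c y| + `|y|
    * `|expR x * b y - 1|))).
    by rewrite toC_le -!normrM lerD2r ler_normD.
  rewrite !rmorphD !rmorphM /= !mulrDr.
  by rewrite !lerD// ler_wpM2r// ?norm_reC ?norm_imC// -[0]/(toC 0) toC_le.
have re0 : reC h @[h --> (0 : Cx R)] --> (0 : R) by exact: (@reC_continuous R
  0).
have im0 : imC h @[h --> (0 : Cx R)] --> (0 : R) by exact: (@imC_continuous R
  0).
have e0 : e1 (reC h) (imC h) @[h --> (0 : Cx R)] --> (0 : R).
  have -> : (0 : R) = `|1 * 1 - 1 : R| + `|0 : R| + `|1 * 1 - 1 : R|.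
    by rewrite mulr1 subrr normr0 !add0r.
  have cosc : cos (imC h) @[h --> (0 : Cx R)] --> (1 : R).
    by rewrite -[X in _ --> X]cos0; apply: (cvg_comp _ _ im0);
      exact: continuous_cos.
  have expc : expR (reC h) @[h --> (0 : Cx R)] --> (1 : R).
    by rewrite -[X in _ --> X]expR0; apply: (cvg_comp _ _ re0);
      exact: continuous_expR.
  have ac' := cvg_comp _ _ re0 ac; have bc' := cvg_comp _ _ im0 bc.
  have cc' := cvg_comp _ _ im0 cc.
  exact: (cvgD (cvgD (cvg_norm (cvgB (cvgM ac' cosc) (cvg_cst _)))
    (cvg_norm cc'))
    (cvg_norm (cvgB (cvgM expc bc') (cvg_cst _)))).
apply/cvgrPdist_lt => e /gt0_toC[d d0 ->].
have e0' : \forall h \near (0 : Cx R)^', `|e1 (reC h) (imC h)| < d.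
  apply: nbhs_dnbhs; move/cvgrPdist_lt : e0 => /(_ d d0).
  by apply: filterS => h; rewrite sub0r normrN.
near=> h; rewrite distrC; apply: le_lt_trans (bound h _) _.
  by near: h; exact: nbhs_dnbhs_neq.
by rewrite toC_lt; apply: le_lt_trans (ler_norm _) _; near: h.
Unshelve. all: end_near. Qed.

Lemma is_derive_cexp z : is_derive z 1 cexp (cexp z).
Proof.
have h : h^-1 *: ((cexp \o shift z) (h *: 1) - cexp z) @[h --> (0 : Cx R)^'] -->
  cexp z.
  rewrite -[X in _ --> X]mulr1;
    apply: cvg_trans (cvgM (cvg_cst (cexp z)) cexp_slope).
  apply: near_eq_cvg; near=> h; rewrite /= [h%:A]mulr1 cexpD -[_ *:
    _]/(h^-1 * _).
  by ring.
split; first by apply/cvg_ex; exists (cexp z).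
exact: cvg_lim h.
Unshelve. all: end_near. Qed.

Lemma unit_cis z : sqnorm z = 1 -> exists a, z = cis a.
Proof.
move=> z1; have h : -1 <= reC z <= 1.
  by rewrite -ler_norml -(ler_pXn2r (ltn0Sn 1)) ?nnegrE// real_normK ?num_real//
    expr1n -z1 lerDl sqr_ge0.
have s : sin (acos (reC z)) = `|imC z|.
  by rewrite sin_acos// -z1 /sqnorm addrAC subrr add0r sqrtr_sqr.
have c : cos (acos (reC z)) = reC z by rewrite acosK// in_itv.
have [i0|i0] := leP 0 (imC z).
  by exists (acos (reC z)); apply: eqCx; rewrite /cis /reC /imC /=
    -/(reC z) ?c// s ger0_norm.
exists (- acos (reC z)); apply: eqCx; rewrite /cis /reC /imC /= -/(reC z) ?cosN
  ?c// sinN s.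
by rewrite ltr0_norm ?opprK.
Qed.

Lemma cexp_surj z : z != 0 -> exists w, cexp w = z.
Proof.
rewrite -sqnorm_eq0 => z0; have z1 : 0 < sqnorm z by rewrite lt_def z0
  sqnorm_ge0.
pose r := Num.sqrt (sqnorm z); have r0 : 0 < r by rewrite sqrtr_gt0.
have [|a aE] := @unit_cis (z / toC r).
  rewrite sqnormM -toCV /sqnorm reC_toC imC_toC expr0n addr0 -/(sqnorm z).
  by rewrite exprVn sqr_sqrtr ?ltW// divff.
exists (ln r +i* a)%C; rewrite /cexp /reC /imC /= lnK ?posrE//
  -aE mulrC divfK//.
by rewrite toC_eq0 gt_eqF.
Qed.

(* The principal logarithm on the half-plane [0 < reC z]. *)
Definition clog1 z : Cx R :=
  (ln (Num.sqrt (sqnorm z)) +i* asin (imC z / Num.sqrt (sqnorm z)))%C.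

Lemma clog1K z : 0 < reC z -> cexp (clog1 z) = z.
Proof.
move=> z0; have s0 : 0 < sqnorm z by rewrite ltr_pwDl// ?sqr_ge0// exprn_gt0.
set r := Num.sqrt (sqnorm z); have r0 : 0 < r by rewrite sqrtr_gt0.
have rr : r ^+ 2 = sqnorm z by rewrite sqr_sqrtr// ltW.
have h : -1 <= imC z / r <= 1.
  rewrite -ler_norml normrM normfV [`|r|]gtr0_norm// ler_pdivrMr// mul1r.
  by rewrite -(ler_pXn2r (ltn0Sn 1)) ?nnegrE ?(ltW r0)// real_normK ?num_real//
    rr /sqnorm lerDr sqr_ge0.
apply: eqCx; rewrite /cexp ?reCMl ?imCMl /clog1 /cis /reC /imC /= -/(imC z) -/r
  lnK ?posrE//.
  rewrite cos_asin//; have -> : 1 - (imC z / r) ^+ 2 = (reC z / r) ^+ 2.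
    by rewrite !exprMn !exprVn rr /sqnorm; field; rewrite -/(sqnorm z) gt_eqF.
  by rewrite sqrtr_sqr ger0_norm ?divr_ge0 ?ltW// mulrC divfK// gt_eqF.
by rewrite asinK ?in_itv// mulrC divfK// gt_eqF.
Qed.

Lemma clog1_1 : clog1 1 = 0.
Proof.
rewrite /clog1 /sqnorm -[reC 1]/1 -[imC 1]/0 expr1n expr0n addr0 sqrtr1 ln1
  mul0r.
rewrite -[in asin _]sin0 sinK// in_itv /=; have := pi_ge0 R => p0.
by rewrite oppr_le0 divr_ge0.
Qed.

Lemma clog1_cvg : clog1 z @[z --> (1 : Cx R)] --> (0 : Cx R).
Proof.
have re1 : reC z @[z --> (1 : Cx R)] --> (1 : R) by exact: (@reC_continuous R
  1).
have im1 : imC z @[z --> (1 : Cx R)] --> (0 : R) by exact: (@imC_continuous R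
  1).
have r1 : Num.sqrt (sqnorm z) @[z --> (1 : Cx R)] --> (1 : R).
  have s1 : sqnorm z @[z --> (1 : Cx R)] --> (1 : R).
    have -> : (1 : R) = 1 * 1 + 0 * 0 by rewrite mulr0 addr0 mulr1.
    by rewrite /sqnorm; under eq_fun do rewrite !expr2;
      exact: (cvgD (cvgM re1 re1) (cvgM im1 im1)).
  rewrite -[X in _ --> X]sqrtr1; apply: (cvg_comp _ _ s1);
    exact: sqrt_continuous.
have lnc : ln (Num.sqrt (sqnorm z)) @[z --> (1 : Cx R)] --> (0 : R).
  rewrite -[X in _ --> X](@ln1 R).
  by apply: (cvg_comp _ _ r1); exact: continuous_ln.
have a0 : asin (0 : R) = 0.
  rewrite -[in LHS]sin0 sinK// in_itv /= oppr_le0; have p0 := pi_ge0 R.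
  by rewrite divr_ge0.
have asc : asin (imC z / Num.sqrt (sqnorm z)) @[z --> (1 : Cx R)] --> (0 : R).
  have q : imC z / Num.sqrt (sqnorm z) @[z --> (1 : Cx R)] --> (0 : R).
    rewrite -[X in _ --> X](mul0r 1^-1).
    exact: (cvgM im1 (cvgV (oner_neq0 R) r1)).
  rewrite -[X in _ --> X]a0; apply: (cvg_comp _ _ q).
  by apply: continuous_asin; rewrite oppr_lt0 ltr01.
exact: (@cvgC_pair _ _ (nbhs (1 : Cx R)) _ clog1 0 lnc asc).
Qed.

(* [clog1] is differentiable at [1] as a continuous local inverse of [cexp]. *)
Lemma is_derive_clog1 : is_derive (1 : Cx R) 1 clog1 1.
Proof.
pose s (u : Cx R) : Cx R := if u == 0 then 1 else u^-1 * (cexp u - 1).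
have sE u : u * s u = cexp u - 1.
  rewrite /s; have [->|u0] := eqVneq u 0; first by rewrite mul0r cexp0 subrr.
  by rewrite mulrA divff// mul1r.
have sc : s u @[u --> (0 : Cx R)] --> (1 : Cx R).
  have h := cexp_slope.
  apply/(@cvgrPdist_lt _ _ _ (nbhs (0 : Cx R))) => e e0.
  move/cvgrPdist_lt : h => /(_ e e0).
  rewrite near_withinE => h; near=> x; rewrite /s; case: eqVneq => [_|x0].
    by rewrite subrr normr0.
  by move: x0; near: x.
have c1 : clog1 (h + 1) @[h --> (0 : Cx R)] --> (0 : Cx R).
  have c0 : (h + 1) @[h --> (0 : Cx R)] --> (1 : Cx R).
    by rewrite -[X in _ --> X]add0r; exact: (cvgD (@cvg_id _ (nbhs (0 : Cx R)))
      (cvg_cst _)).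
  exact: (cvg_comp _ _ c0 clog1_cvg).
have c2 : (s (clog1 (h + 1)))^-1 @[h --> (0 : Cx R)] --> (1 : Cx R).
  rewrite -[X in _ --> X]invr1.
  exact: (cvgV (oner_neq0 (Cx R)) (cvg_comp _ _ c1 sc)).
have rpos : \forall h \near (0 : Cx R), 0 < reC (h + 1).
  have : reC (h + 1) @[h --> (0 : Cx R)] --> (1 : R).
    have c0 : (h + 1) @[h --> (0 : Cx R)] --> (1 : Cx R).
      by rewrite -[X in _ --> X]add0r;
        exact: (cvgD (@cvg_id _ (nbhs (0 : Cx R))) (cvg_cst _)).
    exact: (cvg_comp _ _ c0 (@reC_continuous R 1)).
  by move=> /cvgr_gt; apply; exact: ltr01.
have h : h^-1 *: ((clog1 \o shift 1) (h *: 1) - clog1 1) @[h --> (0 : Cx R)^']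
  --> (1 : Cx R).
  apply: cvg_trans (cvg_trans (cvg_app _ (@nbhs_dnbhs _ (0 : Cx R))) c2).
  apply: near_eq_cvg; near=> h; rewrite /= [h%:A]mulr1 clog1_1 subr0 -[_ *:
    _]/(h^-1 * _).
  have h0 : h != 0 by near: h; exact: nbhs_dnbhs_neq.
  have hp : 0 < reC (h + 1) by near: h; exact: nbhs_dnbhs.
  have := sE (clog1 (h + 1)); rewrite clog1K// addrK => hE.
  have [l0 s0] : clog1 (h + 1) != 0 /\ s (clog1 (h + 1)) != 0.
    by apply/andP; rewrite -negb_or -mulf_eq0 hE.
  by rewrite -[in h^-1]hE invfM mulrC mulrA divff// mul1r.
split; first by apply/cvg_ex; exists 1.
exact: cvg_lim h.
Unshelve. all: end_near. Qed.

Lemma is_derive_is_diff (f : Cx R -> Cx R) z d : is_derive z 1 f d ->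
  is_diff z f ( *:%R^~ d).
Proof.
case=> df dE; split; first exact/derivable1_diffP.
by rewrite (deriv1E df) derive1E dE.
Qed.

(** A branch near [c] is a fixed logarithm [u] of [c] plus [clog1 (w / c)], since [w / c] is close
    to 1. *)
Lemma local_clog c : c != 0 -> exists l : Cx R -> Cx R,
  is_diff c l ( *:%R^~ c^-1) /\ (\forall w \near c, cexp (l w) = w).
Proof.
move=> c0; have [u uE] := cexp_surj c0.
exists (fun w => u + clog1 (w / c)); split.
  have d1 : is_diff (c / c) clog1 ( *:%R^~ 1).
    by rewrite divff//; apply: is_derive_is_diff; exact: is_derive_clog1.
  have d2 : is_diff c (fun w : Cx R => w / c) ( *:%R^~ c^-1).
    exact: (is_diff_scalel c c^-1).
  have d3 := is_diffD (is_diff_cst u c) (is_diff_comp d2 d1).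
  apply: is_diff_eq d3 _; apply/funext => v /=.
  by rewrite -[LHS]/(0 + (v * c^-1) * 1) add0r mulr1.
have : reC (w / c) @[w --> c] --> (1 : R).
  have w1 : (w / c) @[w --> c] --> (1 : Cx R).
    by rewrite -(divff c0); exact: (cvgM (@cvg_id _ (nbhs (c : Cx R)))
      (cvg_cst _)).
  exact: (cvg_comp _ _ w1 (@reC_continuous R 1)).
move=> /cvgr_gt -/(_ _ ltr01); apply: filterS => w wp.
by rewrite cexpD uE clog1K// mulrC divfK.
Qed.

End ComplexExponential.

(** * Differentials of vector-valued maps *)

Section ColumnDifferential.
Context {R : realType}.

Lemma cvg_bigsum (K : numFieldType) (V : normedModType K) (T : Type) (I :
  finType) (F : set_system T) {FF : Filter F} (f : I -> T -> V) (l : I -> V) :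
  (forall i, f i x @[x --> F] --> l i) ->
  (\sum_i f i x) @[x --> F] --> \sum_i l i.
Proof.
move=> h; have -> : (fun t => \sum_i f i t) = \sum_i f i.
  by apply/funext => t; rewrite fct_sumE.
by elim/big_ind2 : _ => // [|g b g' b' gb gb']; [exact: cvg_cst|exact: cvgD].
Qed.

Lemma is_diff_bigsum (V W : normedModType (Cx R)) (I : finType) (f df : I ->
  V -> W) (x : V) :
  (forall i, is_diff x (f i) (df i)) ->
  is_diff x (fun u => \sum_i f i u) (fun u => \sum_i df i u).
Proof.
move=> h.
have -> : (fun u => \sum_i f i u) = \sum_i f i by apply/funext => t;
  rewrite fct_sumE.
have -> : (fun u => \sum_i df i u) = \sum_i df i by apply/funext => t;
  rewrite fct_sumE.
elim/big_ind2 : _ => // [|g b g' b' gb gb']; first exact: is_diff_cst.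
exact: is_diffD.
Qed.

Lemma is_diff_coord m n (M : 'M[Cx R]_(m, n)) i j :
  is_diff M (fun N : 'M[Cx R]_(m, n) => N i j : Cx R) (fun N => N i j).
Proof.
have @f : {linear 'M[Cx R]_(m, n) -> Cx R}.
  by exists (fun N : 'M[Cx R]_(_, _) => N i j); do 2![eexists];
    do ?[constructor];
     rewrite ?mxE// => ? *; rewrite ?mxE//; move=> ?; rewrite !mxE.
rewrite (_ : (fun _ => _) = f)//; split.
  exact/linear_differentiable/coord_continuous.
by rewrite diff_lin//; exact: coord_continuous.
Qed.

Lemma is_diff_mull (V : normedModType (Cx R)) (f df : V -> Cx R) (x : V) (c :
  Cx R) :
  is_diff x f df -> is_diff x (fun u => c * f u) (fun u => c * df u).
Proof. by move=> h; exact: (is_diffZ c h). Qed.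

Lemma is_diff_scale (V W : normedModType (Cx R)) (f df : V -> Cx R) (x : V) (w :
  W) :
  is_diff x f df -> is_diff x (fun u => f u *: w) (fun u => df u *: w).
Proof. by move=> h; exact: (is_diff_comp h (is_diff_scalel (f x) w)). Qed.

Lemma is_diff_col (V : normedModType (Cx R)) m (g dg : V -> 'cV[Cx R]_m) (z : V)
  :
  (forall k, is_diff z (fun y => g y k 0) (fun v => dg v k 0)) ->
    is_diff z g dg.
Proof.
have E (h : V -> 'cV[Cx R]_m) : h = (fun y => \sum_k h y k 0 *: delta_mx k 0).
  apply/funext => y; apply/colP => k; rewrite summxE (bigD1 k)//= big1 ?addr0.
    by rewrite !mxE !eqxx mulr1.
  by move=> j jk; rewrite !mxE eq_sym (negPf jk) mulr0.
move=> h; rewrite (E g) (E dg); apply: is_diff_bigsum => k.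
exact: is_diff_scale.
Qed.

Lemma is_diff_div (V : normedModType (Cx R)) (f g df dg : V -> Cx R) (x : V) :
  is_diff x f df -> is_diff x g dg -> g x != 0 ->
  is_diff x (fun u => f u / g u) (fun v => (df v * g x - f x * dg v) / g x ^+
    2).
Proof.
move=> hf hg g0.
have hV : is_diff x (fun u => (g u)^-1) (fun v => - g x ^- 2 * dg v).
  split; first by apply: differentiableV => //; case: hg.
  by rewrite diffV// (@diff_val _ _ _ _ _ _ _ hg).
apply: is_diff_eq (is_diffM hf hV) _; apply/funext => v.
rewrite -[LHS]/(f x * (- g x ^- 2 * dg v) + (g x)^-1 * df v).
by field.
Qed.

Lemma is_diff_mul_insert n m (A : 'M[Cx R]_(m, n.+1)) k a (y : 'cV[Cx R]_n) c :
  is_diff y (fun u => (A *m insert k a u) c 0) (fun v => (A *m insert k 0 v) c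
    0).
Proof.
have E b : (fun u => (A *m insert k b u) c 0) =
    (fun u : 'cV[Cx R]_n => A c k * b + \sum_i A c (lift k i) * u i 0).
  apply/funext => u; rewrite mxE (bigD1_ord k)//= insertE; congr (_ + _).
  by apply: eq_bigr => i _; rewrite insert_lift.
rewrite !E.
have h : is_diff y (fun u : 'cV[Cx R]_n => \sum_i A c (lift k i) * u i 0)
   (fun u => \sum_i A c (lift k i) * u i 0).
  by apply: is_diff_bigsum => i; apply: is_diff_mull; exact: is_diff_coord.
apply: is_diff_eq (is_diffD (is_diff_cst (A c k * a) y) h) _.
by apply/funext => v; rewrite mulr0.
Qed.

Lemma is_diff_insert n k a (y : 'cV[Cx R]_n) c :
  is_diff y (fun u => insert k a u c 0) (fun v => insert k 0 v c 0).
Proof.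
have := is_diff_mul_insert 1%:M k a y c.
by under eq_fun do rewrite mul1mx; under [X in is_diff _ _ X]eq_fun do
  rewrite mul1mx.
Qed.

Lemma is_diff_affine n (A : 'M[Cx R]_n.+1) k j (y : 'cV[Cx R]_n) :
  (A *m insert k 1 y) j 0 != 0 ->
  is_diff y (fun u => affine j (A *m insert k 1 u))
   (fun v => \col_i (((A *m insert k 0 v) (lift j i) 0 * (A *m insert k 1 y) j 0
     -
     (A *m insert k 1 y) (lift j i) 0 * (A *m insert k 0 v) j 0) / (A *m insert
       k 1 y) j 0 ^+ 2)).
Proof.
move=> h; apply: is_diff_col => i.
rewrite (_ : (fun u => affine j (A *m insert k 1 u) i 0) =
  (fun u => (A *m insert k 1 u) (lift j i) 0 / (A *m insert k 1 u) j 0));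
    last first.
  by apply/funext => u; rewrite mxE.
apply: is_diff_eq (is_diff_div (is_diff_mul_insert _ _ _ _ _)
  (is_diff_mul_insert _ _ _ _ _) h) _.
by apply/funext => v; rewrite [RHS]mxE.
Qed.

End ColumnDifferential.

(** * The torification of the simplex by projective space *)

Section Torification.
Context {R : realType} {n : nat}.
Implicit Types (u : 'cV[Cx R]_n).

(* [v] is the derivative in the direction [V] of the logarithmic coordinates
   [2 log (w_i / w_max)]. *)
Lemma metric_match u (v v' : 'cV[Cx R]_n) (w V V' : 'cV[Cx R]_n.+1) :
  (forall k, w k 0 != 0) ->
  (forall k, simplex R n (re_vec u) k = sqnorm (w k 0) / sqn w) ->
  (forall i, v i 0 = 2 * (V (lift ord_max i) 0 / w (lift ord_max i) 0) -
                     2 * (V ord_max 0 / w ord_max 0)) ->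
  (forall i, v' i 0 = 2 * (V' (lift ord_max i) 0 / w (lift ord_max i) 0) -
                     2 * (V' ord_max 0 / w ord_max 0)) ->
  tangent_metric (simplex R n) u v v' = fubini_study w V V'.
Proof.
move=> w0 pE vE vE'.
have wn0 : w != 0 by apply: contraNneq (w0 ord_max) => ->; rewrite mxE.
have s0 : inner w w != 0 by exact: inner_self_neq0.
(* [m V] is the mean of [V_k / w_k] under the weights [|w_k|^2 / |w|^2]; it stays opaque while the
   squares are expanded. *)
have [m mE] : exists m : 'cV[Cx R]_n.+1 -> Cx R, forall V, m V = inner w V /
  inner w w.
  by eexists.
have pw k : toC (simplex R n (re_vec u) k) = (w k 0)^* * w k 0 / inner w w.
  by rewrite pE rmorphM /= toCV -inner_self conj_mul.
have cE (V0 : 'cV[Cx R]_n.+1) (v0 : 'cV[Cx R]_n) x :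
   (forall i, v0 i 0 = 2 * (V0 (lift ord_max i) 0 / w (lift ord_max i) 0) -
                     2 * (V0 ord_max 0 / w ord_max 0)) ->
   cscore (re_vec u) v0 x = 2 * (V0 x 0 / w x 0 - m V0).
  move=> h; rewrite (@cscore_shift _ _ _ _ (fun x => 2 * (V0 x 0 / w x 0)))//.
  rewrite mulrBr; congr (_ - _); rewrite mE [inner w V0]/inner mulrA
    [2 * _]mulr_sumr mulr_suml.
  by apply: eq_bigr => k _; rewrite pw; field; rewrite s0 w0.
rewrite tangent_metric_simplex /fubini_study.
transitivity (reC (\sum_x toC (simplex R n (re_vec u) x) *
    ((cscore (re_vec u) v x)^* * cscore (re_vec u) v' x))).
  by rewrite raddf_sum; apply: eq_bigr => x _ /=; rewrite reCMl.
rewrite -[4 * _]reCMl; congr reC.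
have mc : (m V)^* = inner V w / inner w w.
  by rewrite mE rmorphM /= fmorphV /= !inner_conj.
transitivity (\sum_x (4 / inner w w) * ((V x 0)^* * V' x 0 - (V x 0)^* * w x 0 *
  m V' - (w x 0)^* * V' x 0 * (m V)^* + (w x 0)^* * w x 0 * ((m V)^* * m V'))).
  apply: eq_bigr => x _; rewrite pw (cE V v x vE) (cE V' v' x vE').
  rewrite !(rmorphM, rmorphB) /= fmorphV /= conjC_nat.
  have wx := w0 x; have wx' : (w x 0)^* != 0 by rewrite conjC_eq0.
  by field; rewrite s0 wx wx'.
rewrite -mulr_sumr big_split /= !sumrB -!mulr_suml -/(inner V V') -/(inner V w)
  -/(inner w V') -/(inner w w).
rewrite mc mE.
have -> : toC 4 = 4 :> Cx R by exact: (rmorph_nat (@toC R) 4).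
by field.
Qed.

(* A torus parameter [t] shifts [u / 2] by [2 pi t i], hence the period
   [4 pi]. *)
Definition torus_lattice : 'M[R]_n := (4 * pi)%:M.
Local Notation Y := torus_lattice.
Local Notation free := (free_locus (proj_torus R n)).

(** The halving makes the squared modulus of the [k]-th entry equal to [expR theta_k], the
    unnormalised probability. *)
Definition expvec u : 'cV[Cx R]_n := \col_k cexp (u k 0 / 2).

Lemma fibre_shiftE t u k :
  fibre_shift Y t u k 0 = u k 0 + (0 +i* (4 * pi * t k 0))%C.
Proof.
rewrite /fibre_shift mxE; congr (_ + _); rewrite [LHS]mxE.
by rewrite /torus_lattice mul_scalar_mx !mxE.
Qed.

Lemma expvec_shift t u : expvec (fibre_shift Y t u) =
  \col_k (cis (2 * pi * t k 0) * expvec u k 0).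
Proof.
apply/colP => k; rewrite [LHS]mxE [RHS]mxE [in RHS]mxE fibre_shiftE mulrDl cexpD
  mulrC.
congr (_ * _); rewrite /cexp.
have -> : (0 +i* (4 * pi * t k 0))%C / 2 = (0 +i* (2 * pi * t k 0))%C :> Cx R.
  apply: (mulIf (x := 2)); first by rewrite pnatr_eq0.
  rewrite divfK ?pnatr_eq0//; apply: eqCx; rewrite ?reCM ?imCM /reC /imC /=;
    ring.
by rewrite /reC /imC /= expR0 rmorph1 mul1r.
Qed.

Lemma cexp_eq1 (z : Cx R) : cexp z = 1 ->
  exists k : int, z = (0 +i* (2 * pi * k%:~R))%C.
Proof.
move=> c1; have r0 : reC z = 0.
  have := congr1 (@sqnorm R) c1; rewrite sqnorm_cexp.
  rewrite /sqnorm -[reC 1]/1 -[imC 1]/0 expr1n expr0n addr0 => /eqP.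
  rewrite sqrf_eq1 => /orP[/eqP|/eqP h]; first by rewrite -[RHS]expR0 =>
    /expR_inj.
  by have := expR_gt0 (reC z); rewrite h ltr0N1.
move: c1; rewrite /cexp r0 expR0 rmorph1 mul1r => c1.
have p0 : 2 * pi != 0 :> R by rewrite mulf_neq0 ?pnatr_eq0// gt_eqF// pi_gt0.
have [|k kE] := @cis_eq1 R (imC z / (2 * pi)); first by rewrite mulrC divfK.
by exists k; apply: eqCx; rewrite ?r0// -kE {2}/imC /= mulrC divfK.
Qed.

Lemma expvec_lattice u v : expvec u = expvec v ->
  exists k : 'cV[int]_n, v = fibre_shift Y (int_vec k) u.
Proof.
move=> /colP uv.
have h i : exists k : int, (v i 0 - u i 0) / 2 = (0 +i* (2 * pi * k%:~R))%C.
  apply: cexp_eq1; have := uv i; rewrite !mxE => e.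
  by apply: (mulfI (cexp_neq0 (u i 0 / 2))); rewrite -cexpD mulr1 e; congr cexp;
    ring.
have [f fE] := choice h; exists (\col_i f i).
apply/colP => i; rewrite fibre_shiftE -[LHS](subrK (u i 0)) addrC;
  congr (_ + _).
have t0 : 2 != 0 :> Cx R by rewrite pnatr_eq0.
rewrite -[LHS](divfK t0) fE !mxE.
by apply: eqCx; rewrite ?reCM ?imCM /reC /imC /=; ring.
Qed.

(** Defined on a chosen representative; [toric_mapE] shows independence of the choice. *)
Definition toric_map (x : toricE (simplex R n) Y) : projS R n :=
  proj (insert ord_max 1 (expvec (repr (x : {eq_quot lattice_equiv Y})))).

Lemma toric_mapE u : toric_map (qL Y u) = proj (insert ord_max 1 (expvec u)).
Proof.
rewrite /toric_map.
have /eqmodP/asboolP[k kE] : u = repr (\pi_({eq_quot lattice_equiv Y}) u)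
    %[mod {eq_quot lattice_equiv Y}] by rewrite reprK.
rewrite -[repr _]/(repr (\pi_({eq_quot lattice_equiv Y}) u)) kE;
  congr (proj (insert _ _ _)).
rewrite expvec_shift; apply/colP => i; rewrite [LHS]mxE.
by rewrite [int_vec k i 0]mxE cis_2pi_int mul1r.
Qed.

Lemma qL_surj (x : toricE (simplex R n) Y) : exists u, x = qL Y u.
Proof. by exists (repr (x : {eq_quot lattice_equiv Y})); rewrite /qL reprK. Qed.

Lemma qL_eq u v : qL Y u = qL Y v <-> exists k : 'cV[int]_n, v = fibre_shift Y
  (int_vec k) u.
Proof. by split=> [/eqmodP/asboolP//|h]; apply/eqmodP/asboolP. Qed.

Lemma expvec_neq0 u k : expvec u k 0 != 0.
Proof. by rewrite mxE cexp_neq0. Qed.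

(** The last coordinate 1 fixes the scale, so injectivity reduces to the period lattice of [expvec].
    Surjectivity takes a logarithm of each ratio [z_i / z_max]. *)
Lemma toric_map_bij : set_bij [set: toricE (simplex R n) Y] free toric_map.
Proof.
split.
- move=> x _; have [u ->] := qL_surj x; rewrite toric_mapE.
  by apply/free_insert => k; exact: expvec_neq0.
- move=> x y _ _; have [u ->] := qL_surj x; have [v ->] := qL_surj y.
  rewrite !toric_mapE => /(proj_eqP (insert1_neq0 _ _) (insert1_neq0 _ _))[l l0
    e].
  have l1 : l = 1.
    by move/colP : e => /(_ ord_max) /=; rewrite [X in _ = X]mxE !insertE mulr1.
  apply/qL_eq/expvec_lattice/colP => i.
  by move/colP : e => /(_ (lift ord_max i)) /=;
    rewrite [X in _ = X]mxE !insert_lift l1 mul1r.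
- move=> x fx; rewrite -(proj_reprK x) in fx *.
  have /(free_locusP (proj_repr_neq0 x)) z0 := fx; set z := proj_repr x in z0 *.
  have h i : exists u : Cx R, cexp (u / 2) = z (lift ord_max i) 0 / z ord_max 0.
    have [|u uE] := @cexp_surj R (z (lift ord_max i) 0 / z ord_max 0).
      by rewrite mulf_neq0 ?invr_eq0.
    by exists (u * 2); rewrite mulfK// pnatr_eq0.
  have [f fE] := choice h.
  exists (qL Y (\col_i f i)) => //;
    rewrite toric_mapE -(proj_affine (z0 ord_max)).
  by congr (proj (insert _ _ _)); apply/colP => i; rewrite !mxE fE.
Qed.

Lemma simplex_expvec u k : simplex R n (re_vec u) k =
  sqnorm (insert ord_max 1 (expvec u) k 0) / sqn (insert ord_max 1 (expvec u)).
Proof.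
have e i : sqnorm (expvec u i 0) = expR (re_vec u i 0).
  rewrite mxE sqnorm_cexp -expRM_natr mxE; congr expR.
  have -> : u i 0 / 2 = toC 2^-1 * u i 0 by rewrite toCV rmorph_nat mulrC.
  by rewrite reCMl; field.
have e1 : sqnorm (1 : Cx R) = 1 by rewrite /sqnorm -[reC 1]/1 -[imC 1]/0 expr1n
  expr0n addr0.
rewrite simplexE; congr (_ / _).
  by case: unliftP => [i ->|->]; rewrite ?insert_lift ?e// insertE e1 expR0.
rewrite /sqn sum_ord_max insertE e1; congr (_ + _).
by apply: eq_bigr => i _; rewrite insert_lift e.
Qed.

Lemma is_diff_expvec u : is_diff u expvec (fun v =>
  \col_k (v k 0 / 2 * cexp (u k 0 / 2))).
Proof.
apply: is_diff_col => k.
rewrite (_ : (fun y => _) = cexp \o (fun y : 'cV[Cx R]_n => 2^-1 * y k 0));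
  last first.
  by apply/funext => y; rewrite /= [LHS]mxE mulrC.
have d1 := is_diff_mull 2^-1 (is_diff_coord u k 0).
have d2 := is_derive_is_diff (is_derive_cexp (2^-1 * u k 0)).
apply: is_diff_eq (is_diff_comp d1 d2) _.
apply/funext => v; rewrite [RHS]mxE -[LHS]/((2^-1 * v k 0) * cexp
  (2^-1 * u k 0)).
by rewrite ![2^-1 * _]mulrC.
Qed.

Lemma toric_map_hol : hol_isometric_on [set: toricE (simplex R n) Y] toric_map.
Proof.
move=> U u _ _; exists ord_max, expvec; have d := is_diff_expvec u; split.
- by apply: (@filterE _ (nbhs u)) => y; split => //; exact: toric_mapE.
- by case: d.
- move=> v w /=; rewrite (@diff_val _ _ _ _ _ _ _ d); apply/esym.
  apply: metric_match.
  + by move=> k; case: (unliftP ord_max k) => [i ->|->];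
      rewrite ?insert_lift ?expvec_neq0// insertE oner_eq0.
  + exact: simplex_expvec.
  + move=> i; rewrite !insert_lift !insertE !mxE mul0r mulr0 subr0.
    by field; rewrite cexp_neq0.
  + move=> i; rewrite !insert_lift !insertE !mxE mul0r mulr0 subr0.
    by field; rewrite cexp_neq0.
Qed.

(** Coordinates of two points of the ball differ by less than 2, whereas the lattice moves a
    coordinate by [4 pi |k|], which is at least [8 |k|]. *)
Lemma qL_inj_ball u : set_inj (ball u (1 : Cx R)) (qL Y).
Proof.
move=> v w /set_mem bv /set_mem bw /qL_eq[k wE].
have kz : k = 0.
  apply/colP => i; rewrite mxE.
  have vi : `|u i 0 - v i 0| < 1 by case: bv => _; apply.
  have wi : `|u i 0 - w i 0| < 1 by case: bw => _; apply.
  have : `|w i 0 - v i 0| < toC 2.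
    have -> : w i 0 - v i 0 = (u i 0 - v i 0) - (u i 0 - w i 0) by ring.
    by apply: le_lt_trans (ler_normB _ _) _; rewrite rmorph_nat -[2]/(1 + 1)
      ltrD.
  move=> /(le_lt_trans (norm_imC _)); rewrite toC_lt wE fibre_shiftE addrAC
    subrr add0r.
  rewrite /imC /= [int_vec k i 0]mxE => h.
  have p := pi_ge2 R.
  apply/eqP; rewrite -normr_le0 -ltzD1 add0r -(ltr_int R) intr_norm.
  have h' : 8 * `|(k i 0)%:~R : R| <= `|4 * pi * (k i 0)%:~R|.
    rewrite normrM ler_wpM2r// gtr0_norm; lra.
  lra.
by rewrite wE kz /int_vec map_mx0 fibre_shift0.
Qed.

(** The inverse on the free locus; elsewhere the default value [qL Y 0]. *)
Definition toric_inv (x : projS R n) : toricE (simplex R n) Y :=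
  xget (qL Y 0) [set y | toric_map y = x].

Lemma toric_mapK x : toric_inv (toric_map x) = x.
Proof.
rewrite /toric_inv; case: xgetP => [y -> /= yx|h]; last by case: (h x).
by case: toric_map_bij => _ inj _; apply: inj; rewrite ?inE.
Qed.

Lemma toric_inv_hol : hol_isometric_on free toric_inv.
Proof.
move=> i y _ fy; set w := insert i 1 y.
have w0 : forall k, w k 0 != 0 by apply/(free_locusP (insert1_neq0 _ _)).
pose q (k : 'I_n) (u : 'cV[Cx R]_n) := insert i 1 u (lift ord_max k) 0 / insert
  i 1 u ord_max 0.
have dq k := is_diff_div (is_diff_insert i 1 y (lift ord_max k)) (is_diff_insert
  i 1 y ord_max) (w0 ord_max).
have h k : exists l : Cx R -> Cx R, is_diff (q k y) l ( *:%R^~ (q k y)^-1) /\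
    (\forall w \near q k y, cexp (l w) = w).
  by apply: local_clog; rewrite mulf_neq0 ?invr_eq0.
have [l lE] := choice h.
(* In charts the inverse is twice a logarithm of each ratio [q k], with a separate branch [l k]
   chosen near the value at [y]. *)
pose g u : 'cV[Cx R]_n := \col_k (2 * l k (q k u)).
have dg : is_diff y g (fun v =>
  \col_k (2 * ((insert i 0 v (lift ord_max k) 0 * w ord_max 0 -
   w (lift ord_max k) 0 * insert i 0 v ord_max 0) / w ord_max 0 ^+ 2 *
     (q k y)^-1))).
  apply: is_diff_col => k.
  rewrite (_ : (fun y => g y k 0) = (fun u => 2 * (l k \o q k) u)); last first.
    by apply/funext => u; rewrite [LHS]mxE.
  have dl : is_diff (q k y) (l k) ( *:%R^~ (q k y)^-1) by case: (lE k).
  have d := is_diff_mull 2 (is_diff_comp (dq k) dl).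
  apply: is_diff_eq d _.
  by apply/funext => v; rewrite [RHS]mxE.
have dgd : differentiable g y by case: dg.
have cg := differentiable_continuous dgd.
have gE : \forall u \near y, expvec (g u) = affine ord_max (insert i 1 u).
  have qn k : \forall u \near y, cexp (l k (q k u)) = q k u.
    have cq : {for y, continuous (q k)} by apply: differentiable_continuous;
      case: (dq k).
    by case: (lE k) => _ hk; exact: (cq _ hk).
  have := @filter_forall _ _ (fun k (u : 'cV[Cx R]_n) => cexp (l k (q k u)) =
    q k u) (nbhs y) (nbhs_filter y) qn.
  apply: (@filterS _ (nbhs y)) => u hu; apply/colP => k;
    rewrite [LHS]mxE [RHS]mxE -[RHS]/(q k u) -hu.
  by congr cexp; rewrite [g u k 0]mxE; rewrite mulrC mulKf// pnatr_eq0.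
clearbody g.
have FF : Filter (nbhs y) := nbhs_filter y.
have wn : \forall u \near y, insert i 1 u ord_max 0 != 0.
  have := near_free fy; apply: (@filterS _ (nbhs y)) => u.
  by move=> /(free_locusP (insert1_neq0 _ _)).
(* A chart of the quotient around [qL (g y)]: an open set on which [qL] is injective. *)
have [B [oB iB B1]] : exists B : set 'cV[Cx R]_n,
    [/\ open B, set_inj B (qL Y) & nbhs (g y) B].
  exists (ball (g y) (1 : Cx R)); split; [exact: ball_open|exact: qL_inj_ball|].
  by apply: nbhsx_ballx; rewrite ltr01.
have nb : \forall u \near y, B (g u) := cg _ B1.
exists (exist _ B (conj oB iB)), g; split.
- have := @filterI _ (nbhs y) FF _ _ nb (@filterI _ (nbhs y) FF _ _ gE wn).
  apply: (@filterS _ (nbhs y)) => u [bu [eu wu]]; split; first exact: bu.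
  rewrite /= -(toric_mapK (qL Y (g u))) toric_mapE; congr toric_inv.
  by rewrite eu proj_affine.
- exact: dgd.
- move=> v v' /=; rewrite (@diff_val _ _ _ _ _ _ _ dg).
  apply: metric_match => //.
  + move=> k; rewrite simplex_expvec (nbhs_singleton gE) (insert_affine (w0 _))
      -/w.
    rewrite [_ k 0]mxE sqnormM.
    rewrite sqnZ -mulf_div divff ?mul1r// sqnorm_eq0 invr_eq0; exact: w0.
  + move=> k; rewrite mxE /q -/w; field.
    by rewrite !w0.
  + move=> k; rewrite mxE /q -/w; field.
    by rewrite !w0.
Qed.

End Torification.

(** * The quotient topology of projective space *)

Section ProjectiveTopology.
Context {R : realType} {n : nat}.
Implicit Types (z w : 'cV[Cx R]_n.+1) (x : projS R n).

Lemma pi_proj (y : @nzvec R n) :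
  \pi_(quotient_topology {eq_quot (@proj_equiv R n)}) y = proj (val y) :>
    proj_pt.
Proof. by rewrite /proj valKd. Qed.

Lemma proj_cvg z : z != 0 -> proj w @[w --> z] --> proj z.
Proof.
move=> z0 V pV.
have oO' : open (interior V) by exact: open_interior.
have O'z : interior V (proj z) := pV.
(* An open set of the quotient pulls back to the trace on the nonzero vectors of an open set [W] of
   the whole space. *)
have [W oW WE] : open ((\pi_(quotient_topology {eq_quot (@proj_equiv R n)}) :
  nzvec -> _) @^-1` interior V) := oO'.
have zP : z \in [set z : 'cV[Cx R]_n.+1 | z != 0] by exact/mem_set.
have Wz : W z.
  suff : (set_val @^-1` W) (exist _ z zP : nzvec) by [].
  by rewrite WE /= pi_proj.
have z0n := near_neq0 z0.
have Wn : nbhs z W by exact: open_nbhs_nbhs.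
have := @filterI _ (nbhs z) (nbhs_filter z) _ _ Wn z0n.
apply: (@filterS _ (nbhs z)) => w [Ww w0];
  apply: (@interior_subset _ V (proj w)).
have wP : w \in [set z : 'cV[Cx R]_n.+1 | z != 0] by exact/mem_set.
have : (set_val @^-1` W) (exist _ w wP : nzvec) by [].
by rewrite WE /= pi_proj.
Qed.

(** The projection is open: the saturation of an open set is the union of its preimages under all
    nonzero scalings. *)
Lemma proj_nbhs z (B : set 'cV[Cx R]_n.+1) : z != 0 -> nbhs z B ->
  nbhs (proj z) [set x | exists2 w, w != 0 /\ B w & x = proj w].
Proof.
move=> z0 zB; have oB' : open (interior B) by exact: open_interior.
have B'z : interior B z := zB.
rewrite nbhsE; exists [set x | exists2 w, w != 0 /\ interior B w & x = proj w];
  last first.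
  by move=> x [w [w0 /interior_subset Bw] ->]; exists w.
split; last by exists z.
suff : open ((\pi_(quotient_topology {eq_quot (@proj_equiv R n)}) : nzvec -> _)
  @^-1`
  [set x | exists2 w, w != 0 /\ interior B w & x = proj w]) by [].
exists (\bigcup_(l in [set l : Cx R | l != 0]) (( *:%R l) @^-1` interior B)).
  apply: bigcup_open => l _; apply: open_comp => // w _;
    exact: scaler_continuous.
apply/seteqP; split=> [y [l /= l0 Bl]|y [w [w0 Bw]]].
  rewrite pi_proj; exists (l *: val y); last by rewrite proj_scale// nzvec_neq0.
  by split => //; rewrite scaler_eq0 negb_or l0 nzvec_neq0.
rewrite pi_proj => /(proj_eqP (nzvec_neq0 y) w0)[l l0 wE].
exists l; first exact: l0.
by move: Bw; rewrite wE.
Qed.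

Lemma projS_continuous (T : topologicalType) (f : projS R n -> T) :
  (forall z, z != 0 -> f (proj w) @[w --> z] --> f (proj z)) -> continuous f.
Proof.
move=> h x A fA; rewrite -(proj_reprK x) in fA *.
have := h _ (proj_repr_neq0 x) _ fA => B.
have := proj_nbhs (proj_repr_neq0 x) B;
  apply: (@filterS _ (nbhs (proj (proj_repr x)))).
by move=> _ [w [w0 Bw] ->].
Qed.

End ProjectiveTopology.

(** * The natural extension given by the squared moduli of the coordinates *)

Section NaturalExtension.
Context {R : realType} {n : nat}.
Implicit Types (z w : 'cV[Cx R]_n.+1) (x : projS R n).
Local Notation free := (free_locus (proj_torus R n)).

Definition moment x (k : 'I_n.+1) : R :=
  sqnorm (proj_repr x k 0) / sqn (proj_repr x).

Lemma moment_proj z k : z != 0 -> moment (proj z) k = sqnorm (z k 0) / sqn z.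
Proof.
move=> z0; rewrite /moment; have [l l0 ->] := proj_repr_proj z0.
rewrite mxE sqnormM sqnZ -mulf_div divff ?mul1r//.
by rewrite sqnorm_eq0.
Qed.

Lemma sqnorm_continuous : continuous (@sqnorm R).
Proof.
move=> z.
have := cvgD (cvgM (@reC_continuous R z) (@reC_continuous R z))
  (cvgM (@imC_continuous R z) (@imC_continuous R z)).
exact.
Qed.

Lemma sqn_continuous : continuous (@sqn R n.+1).
Proof.
move=> z.
have c k : sqnorm ((w : 'cV[Cx R]_n.+1) k 0) @[w --> z] --> sqnorm (z k 0).
  exact: (@cvg_comp _ _ _ (fun w : 'cV[Cx R]_n.+1 => w k 0) (@sqnorm R) _ _ _
    (@coord_continuous _ n.+1 1 k 0 z) (@sqnorm_continuous (z k 0))).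
exact: (@cvg_bigsum _ _ _ _ (nbhs z) (nbhs_filter z) _ _ c).
Qed.

Lemma moment_cvg z k : z != 0 -> moment (proj w) k @[w --> z] -->
  moment (proj z) k.
Proof.
move=> z0; rewrite moment_proj//.
have c1 : sqnorm ((w : 'cV[Cx R]_n.+1) k 0) @[w --> z] --> sqnorm (z k 0).
  exact: (@cvg_comp _ _ _ (fun w : 'cV[Cx R]_n.+1 => w k 0) (@sqnorm R) _ _ _
    (@coord_continuous _ n.+1 1 k 0 z) (@sqnorm_continuous (z k 0))).
have s0 : sqn z != 0 by rewrite sqn_eq0.
have c := cvgM c1 (cvgV s0 (@sqn_continuous z)).
have {}c := c (nbhs_filter z) (nbhs_filter z).
have z0n := near_neq0 z0.
apply: cvg_trans c; apply: (@near_eq_cvg _ _ (nbhs z) (nbhs_filter z)).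
apply: (@filterS _ (nbhs z)) z0n => w w0.
by rewrite moment_proj.
Qed.

Lemma moment_continuous : continuous (moment : projS R n -> {ptws 'I_n.+1 ->
  R}).
Proof.
move=> x; have FF := nbhs_filter x.
have FM : Filter (moment y @[y --> x]) := fmap_filter _ FF.
(* The pointwise topology is the supremum of those induced by the evaluations, so each coordinate is
   treated separately. *)
apply/cvg_sup => k A [_ [[B oB <-] Bk] sBA].
have /(_ x) ck : continuous (fun x => moment x k).
  by apply: projS_continuous => z z0; exact: moment_cvg.
have Bn : nbhs (moment x k) B by exact: open_nbhs_nbhs.
have := ck _ Bn; apply: (@filterS _ (nbhs x)) => y By.
exact: sBA.
Qed.

Lemma moment_compatible : compatible_projection (simplex R n) (proj_torus R n)
  moment.
Proof.
exists torus_lattice, toric_map; split.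
- have p0 : 4 * pi != 0 :> R by rewrite mulf_neq0 ?pnatr_eq0// gt_eqF// pi_gt0.
  by rewrite unitmxE det_scalar unitrX ?unitfE.
- split; [exact: toric_map_bij|exact: toric_map_hol|].
  by exists toric_inv; split; [move=> x _;
    exact: toric_mapK|exact: toric_inv_hol].
- move=> t u; rewrite !toric_mapE proj_torus_proj ?insert1_neq0//.
  congr proj; apply/colP => j; rewrite [RHS]mxE.
  case: unliftP => [i ->|->]; rewrite ?insertE// !insert_lift expvec_shift.
  by rewrite [LHS]mxE.
- move=> u; rewrite toric_mapE; apply/funext => k.
  by rewrite moment_proj ?insert1_neq0// -simplex_expvec.
Qed.

Lemma moment_free x : free x -> range (simplex R n) (moment x).
Proof.
have [_ _ surj] := @toric_map_bij R n.
move=> /surj[y _ <-]; have [u ->] := qL_surj y.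
exists (re_vec u) => //; rewrite toric_mapE; apply/funext => k.
by rewrite moment_proj ?insert1_neq0// -simplex_expvec.
Qed.

(** Moving along [(1, ..., 1)] takes a zero coordinate off 0 at once and keeps a nonzero one nonzero
    for small [t]. *)
Lemma free_dense z : z != 0 ->
  \forall t \near (0 : R)^', free (proj (z + toC t *: const_mx 1)).
Proof.
move=> z0.
have h : \forall t \near (0 : R)^', forall k, (z + toC t *: const_mx 1) k 0 !=
  0.
  apply: filter_forall => k.
  have [zk|zk] := eqVneq (z k 0) 0.
    near=> t; rewrite !mxE zk add0r mulr1 toC_eq0; near: t;
      exact: nbhs_dnbhs_neq.
  apply: nbhs_dnbhs; apply: (@near_line _ _ _ _ (fun w => w k 0 != 0)).
  exact: (cvgr_neq0 _ (@coord_continuous _ n.+1 1 k 0 z) zk).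
near=> t; have ht : forall k, (z + toC t *: const_mx 1) k 0 != 0 by near: t.
apply/free_locusP => //; apply: contraNneq (ht ord0) => ->; by rewrite mxE.
Unshelve. all: end_near. Qed.

(** By continuity [moment x] is approximated by its values at nearby free points, which belong to
    the simplex family. *)
Lemma moment_closure x :
  closure (range (simplex R n) : set {ptws 'I_n.+1 -> R}) (moment x).
Proof.
move=> A /moment_continuous; rewrite -(proj_reprK x); set z := proj_repr x.
have z0 : z != 0 by exact: proj_repr_neq0.
move=> /(proj_cvg z0)/= hA.
have h1 := nbhs_dnbhs (near_line (const_mx 1) hA).
have [t [ft At]] := @filter_ex _ (0 : R)^' _ _ (filterI (free_dense z0) h1).
by exists (moment (proj (z + toC t *: const_mx 1))); split => //;
  exact: moment_free.
Qed.

Lemma moment_natural : natural_extension (simplex R n) (proj_torus R n) moment.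
Proof.
exists moment; split => //;
  [exact: moment_compatible|exact: moment_continuous|].
exact: moment_closure.
Qed.

End NaturalExtension.

(** * Unitary matrices as elements of the identity component *)

Section Unitary.
Context {R : realType} {n : nat}.
Implicit Types (z w : 'cV[Cx R]_n.+1) (x : projS R n) (A B : 'M[Cx R]_n.+1).

Local Notation adj A := (map_mx Num.conj A^T).

Lemma adjmxK A : adj (adj A) = A.
Proof. exact: trmxCK. Qed.

Lemma adjmxM A B : adj (A *m B) = adj B *m adj A.
Proof. by rewrite trmx_mul map_mxM. Qed.

Lemma adjmx_diag (d : 'rV[Cx R]_n.+1) : adj (diag_mx d) =
  diag_mx (map_mx Num.conj d).
Proof. by rewrite tr_diag_mx map_diag_mx. Qed.

Definition pmap A x : projS R n := proj (A *m proj_repr x).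

Definition isometrymx A := map_mx Num.conj A^T *m A = 1%:M.

Lemma isometry_neq0 A z : isometrymx A -> z != 0 -> A *m z != 0.
Proof.
move=> hA; apply: contraNneq => /(congr1 (mulmx (map_mx Num.conj A^T))).
by rewrite mulmxA hA mul1mx mulmx0 => ->.
Qed.

Lemma pmap_proj A z : isometrymx A -> z != 0 -> pmap A (proj z) = proj (A *m z).
Proof.
move=> hA z0; rewrite /pmap; have [l l0 ->] := proj_repr_proj z0.
by rewrite -scalemxAr proj_scale// isometry_neq0.
Qed.

Lemma isometrymx_adj A : isometrymx A -> isometrymx (map_mx Num.conj A^T).
Proof.
by move=> /mulmx1C hA; rewrite /isometrymx adjmxK.
Qed.

Lemma pmapK A : isometrymx A -> cancel (pmap A) (pmap (map_mx Num.conj A^T)).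
Proof.
move=> hA x; rewrite -(proj_reprK x) pmap_proj ?proj_repr_neq0//.
rewrite pmap_proj ?isometry_neq0 ?proj_repr_neq0//; last exact: isometrymx_adj.
by rewrite mulmxA hA mul1mx.
Qed.

Lemma pmap_hol A : isometrymx A -> hol_isometric_on [set: projS R n] (pmap A :
  projS R n -> projS R n).
Proof.
move=> hA k y _ _; set z := insert k 1 y.
have [j zj] := nonzero_coord (isometry_neq0 hA (insert1_neq0 k y)).
have d := is_diff_affine zj.
exists j, (fun u => affine j (A *m insert k 1 u)); split.
- have dj := is_diff_mul_insert A k 1 y j.
  have cj : {for y, continuous (fun u => (A *m insert k 1 u) j 0)}.
    by apply: differentiable_continuous; case: dj.
  have := @cvgr_neq0 _ _ _ (nbhs y) (nbhs_filter y) _ _ cj zj.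
  apply: (@filterS _ (nbhs y)) => u uj; split => //=.
  by rewrite pmap_proj ?insert1_neq0// proj_affine.
- by case: d.
- move=> v w /=; rewrite (@diff_val _ _ _ _ _ _ _ d).
  rewrite -[RHS](fubini_study_unitary _ _ _ hA); set c := (A *m z) j 0.
  (* The quotient rule for the affine coordinates gives [A v] divided by [c], up to a multiple of
     [A z] that [fubini_study_eq] absorbs. *)
  have dE (u : 'cV[Cx R]_n) :
    insert j 0 (\col_i (((A *m insert k 0 u) (lift j i) 0 * c -
      (A *m z) (lift j i) 0 * (A *m insert k 0 u) j 0) / c ^+ 2)) =
      c^-1 *: (A *m insert k 0 u) + (- ((A *m insert k 0 u) j 0 / c ^+ 2)) *:
        (A *m z).
    have c0 : c != 0 := zj.
    apply: (@insertP _ _ j) => [|i].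
      by rewrite insertE [RHS]mxE [X in X + _]mxE [X in _ + X]mxE -/c; field.
    rewrite insert_lift [LHS]mxE [RHS]mxE [X in _ = X + _]mxE [X in _ =
      _ + X]mxE.
    by field.
  apply: (fubini_study_eq _ _ (dE v) (dE w)); first by rewrite invr_eq0.
  exact: insert_affine.
Qed.

Lemma pmap_isometry A : isometrymx A -> hol_isometries (pmap A : projS R n ->
  projS R n).
Proof.
move=> hA; have hA' := isometrymx_adj hA.
split.
- split=> [x _|x y _ _|x _]; [exact: I|exact: (can_inj (pmapK hA))|].
  by exists (pmap (map_mx Num.conj A^T) x) => //; have := pmapK hA' x;
    rewrite adjmxK.
- exact: pmap_hol.
- exists (pmap (map_mx Num.conj A^T)); split; first by move=> x _; exact: pmapK.
  exact: pmap_hol.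
Qed.

Lemma mulmx_continuous A : continuous (fun z => A *m z).
Proof.
move=> z; apply: differentiable_continuous.
suff : is_diff z (fun z => A *m z) (fun z => A *m z) by case.
apply: is_diff_col => k.
rewrite (_ : (fun w => _) = (fun w : 'cV[Cx R]_n.+1 => \sum_j A k j * w j 0));
  last first.
  by apply/funext => w; rewrite mxE.
by apply: is_diff_bigsum => j; apply: is_diff_mull; exact: is_diff_coord.
Qed.

Lemma cis_continuous : continuous (@cis R).
Proof.
move=> a; apply: cvgC_pair; [exact: continuous_cos|exact: continuous_sin].
Qed.

Section Path.
Variables (V : 'M[Cx R]_n.+1) (a : 'I_n.+1 -> R).
Hypothesis hV : isometrymx V.

Definition upath (s : R) : 'M[Cx R]_n.+1 :=
  map_mx Num.conj V^T *m diag_mx (\row_k cis (s * a k)) *m V.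

Lemma cis_conj (b : R) : (cis b)^* = cis (- b) :> Cx R.
Proof.
by apply: eqCx; rewrite ?reC_conj ?imC_conj /cis /reC /imC /= ?cosN ?sinN.
Qed.

Lemma upath_isometry s : isometrymx (upath s).
Proof.
rewrite /isometrymx /upath !adjmxM adjmxK adjmx_diag.
have VV : V *m map_mx Num.conj V^T = 1%:M by exact: mulmx1C.
rewrite -!mulmxA (mulmxA V) VV mul1mx (mulmxA (diag_mx _)) mulmx_diag.
rewrite (_ : diag_mx _ = 1%:M) ?mul1mx//.
by apply/matrixP => i j; rewrite !mxE cis_conj -cisD addNr cis0.
Qed.

(** Only the scalar coefficients depend on [s], so joint continuity in [s] and [z] reduces to
    finitely many products. *)
Lemma upath_sum s z : upath s *m z =
  \sum_k cis (s * a k) *: ((map_mx Num.conj V^T *m delta_mx k k *m V) *m z).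
Proof.
rewrite /upath -mulmxA; set u := V *m z.
have -> : diag_mx (\row_k cis (s * a k)) = \sum_k cis (s * a k) *: delta_mx k k.
  by rewrite diag_mx_sum_delta; apply: eq_bigr => k _; rewrite mxE.
rewrite mulmx_sumr mulmx_suml; apply: eq_bigr => k _.
by rewrite -scalemxAr -scalemxAl !mulmxA.
Qed.

Lemma upath_cvg s0 z0 :
  (upath p.1 *m p.2) @[p --> (s0, z0)] --> upath s0 *m z0.
Proof.
rewrite upath_sum.
under eq_fun do rewrite upath_sum.
have F : Filter (nbhs (s0, z0)) := nbhs_filter (s0, z0).
apply: (@cvg_bigsum _ _ _ _ (nbhs (s0, z0)) F
  (fun k p => cis (p.1 * a k) *: (map_mx Num.conj V^T *m delta_mx k k *m V *m
    p.2))) => k.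
have c1 : p.1 @[p --> (s0, z0)] --> s0 by exact: cvg_fst.
have c2 : p.2 @[p --> (s0, z0)] --> z0 by exact: cvg_snd.
apply: cvgZ.
  have c3 : (p.1 * a k) @[p --> (s0, z0)] --> s0 * a k.
    exact: (@cvgM _ _ (nbhs (s0, z0)) F _ _ _ _ c1 (cvg_cst (a k))).
  exact: (cvg_comp _ _ c3 (@cis_continuous (s0 * a k))).
exact: (cvg_comp _ _ c2 (@mulmx_continuous _ z0)).
Qed.

(** Joint continuity is what currying turns into continuity of the path in the compact-open
    topology. *)
Lemma pmap_upath_continuous :
  continuous (fun p : R * projS R n => pmap (upath p.1) p.2).
Proof.
move=> [s x] A /=; rewrite -(proj_reprK x); set z := proj_repr x.
have z0 : z != 0 by exact: proj_repr_neq0.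
rewrite pmap_proj//; last exact: upath_isometry.
move=> /(proj_cvg (isometry_neq0 (upath_isometry s) z0)) /(@upath_cvg s z).
case=> -[P Q] /= [Ps Qz] PQ.
exists (P, [set x | exists2 w, w != 0 /\ Q w & x = proj w]) => /=.
  by split => //; exact: proj_nbhs.
move=> [t _] /= [Pt [w [w0 Qw] ->]]; rewrite pmap_proj//;
  last exact: upath_isometry.
exact: (PQ (t, w)).
Qed.

(** The image of [[0, 1]] is a connected set of isometries containing the identity, at [s = 0], and
    [pmap U], at [s = 1]. *)
Lemma upath_component (U : 'M[Cx R]_n.+1) : upath 1 = U -> identity_component
  (pmap U : projS R n -> projS R n).
Proof.
move=> <-; pose f (s : R) : {compact-open, projS R n -> projS R n} :=
  pmap (upath s).
have cf : continuous f by exact: (continuous_curry_fun pmap_upath_continuous).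
exists (f @` `[0, 1]); last by exists 1 => //=; rewrite in_itv /= ler01 lexx.
split.
- exists 0; first by rewrite /= in_itv /= ler01 lexx.
  apply/funext => x; rewrite /f -[RHS](proj_reprK x) -[in LHS](proj_reprK x).
  rewrite pmap_proj ?proj_repr_neq0//; last exact: upath_isometry.
  congr proj; rewrite /upath (_ : diag_mx _ = 1%:M); last first.
    by apply/matrixP => i j; rewrite !mxE mul0r cis0.
  by rewrite mulmx1 hV mul1mx.
- by move=> _ [s _ <-]; exact: pmap_isometry (upath_isometry s).
- apply: connected_continuous_connected; first exact: segment_connected.
  exact: continuous_subspaceT.
Qed.

End Path.

Lemma unitary_component A : isometrymx A -> identity_component (pmap A :
  projS R n -> projS R n).
Proof.
move=> hA.
have nA : A \is normalmx by apply/normalmxP; rewrite [LHS](mulmx1C hA) [RHS]hA.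
set V := spectralmx A; set d := spectral_diag A.
have uV : V \is unitarymx by exact: spectral_unitarymx.
have hV : isometrymx V by apply: mulmx1C; exact/unitarymxP.
have AE : A = map_mx Num.conj V^T *m diag_mx d *m V.
  by have /orthomx_spectralP := nA; rewrite invmx_unitary.
(* The diagonal form of a unitary matrix is unitary, so its entries have modulus 1 and are of the
   form [cis b]. *)
have hD : map_mx Num.conj (diag_mx d)^T *m diag_mx d = 1%:M.
  have dE : diag_mx d = V *m A *m map_mx Num.conj V^T.
    have VV : V *m map_mx Num.conj V^T = 1%:M by exact: mulmx1C.
    by rewrite AE !mulmxA VV mul1mx -mulmxA VV mulmx1.
  rewrite dE !adjmxM adjmxK -!mulmxA (mulmxA (map_mx Num.conj V^T)) hV mul1mx.
  by rewrite (mulmxA (map_mx Num.conj A^T)) hA mul1mx; exact: mulmx1C.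
have h k : exists b : R, d 0 k = cis b.
  apply: unit_cis; apply: (@toC_inj R).
  rewrite -conj_mul; have /matrixP/(_ k k) := hD.
  by rewrite tr_diag_mx map_diag_mx mulmx_diag !mxE eqxx !mulr1n rmorph1.
have [b bE] := choice h.
apply: (@upath_component V b hV).
rewrite AE /upath; congr (_ *m diag_mx _ *m _); apply/rowP => k.
by rewrite mxE mul1r bE.
Qed.

End Unitary.

(** In an orthonormal eigenbasis [f_H] becomes the mean of the eigenvalues under the weights
    [|(P z)_k|^2 / |z|^2]. *)
Lemma is_spectrum_exists (R : realType) n (H : 'M[Cx R]_n.+1) :
  H \is hermsymmx -> exists S : set R,
  is_spectrum (simplex R n) (proj_torus R n) (simplexF R n) (fH H) S.
Proof.
move=> hH; have nH := hermitian_normalmx hH.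
set P := spectralmx H; set d := spectral_diag H.
have uP : P \is unitarymx by exact: spectral_unitarymx.
have hP : isometrymx P by apply: mulmx1C; exact/unitarymxP.
have HE : H = map_mx Num.conj P^T *m diag_mx d *m P.
  by have /orthomx_spectralP := nH; rewrite invmx_unitary.
pose X k : R := reC (d 0 k).
exists (range X), moment, (pmap P), X; split => //.
- exact: moment_natural.
- exact: unitary_component.
- exists (X ord_max), (fun i => X (lift ord_max i) - X ord_max) => x.
  by rewrite sum_simplexF; case: unliftP => [i ->|->]; rewrite ?subrK ?add0r.
- move=> x; rewrite -(proj_reprK x); set z := proj_repr x.
  have z0 : z != 0 by exact: proj_repr_neq0.
  rewrite fH_proj// pmap_proj// -[LHS]/(rayleigh H z) rayleighE.
  have sP : sqn (P *m z) = sqn z.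
    by apply: (@toC_inj R); rewrite -!inner_self inner_adj mulmxA hP mul1mx.
  rewrite /expect.
  under eq_bigr do rewrite moment_proj ?isometry_neq0// sP mulrA.
  rewrite -mulr_suml; congr (_ / _).
  have -> : inner z (H *m z) = inner (P *m z) (diag_mx d *m (P *m z)).
    by rewrite HE -!mulmxA inner_adj adjmxK.
  rewrite /inner raddf_sum; apply: eq_bigr => k _ /=.
  have -> : (diag_mx d *m (P *m z)) k 0 = d 0 k * (P *m z) k 0.
    by rewrite mul_diag_mx mxE.
  by rewrite mulrCA conj_mul mulrC reCMl mulrC.
Qed.

(** As [is_spectrum] is a relation, the first clause shows that [f_H] has a spectrum; by the second
    and injectivity of [toC] it is unique. *)
Theorem proposition6p24 (R : realType) (n : nat) (H : 'M[Cx R]_n.+1) :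
  H \is hermsymmx ->
  (exists S : set R,
     is_spectrum (simplex R n) (proj_torus R n) (simplexF R n) (fH H) S) /\
  (forall S : set R,
     is_spectrum (simplex R n) (proj_torus R n) (simplexF R n) (fH H) S ->
     image S (@toC R) = spec_mx H).
Proof.
move=> hH; split; first exact: is_spectrum_exists.
by move=> S; exact: is_spectrum_unique.
Qed.
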